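(* Let $\lambda_1,\lambda_2>0$. A left-invariant Riemannian metric on $SO(3)$ with eigenvalues $\{\lambda_1^2,\lambda_2^2,1\}$ has nonnegative sectional curvature if and only if the following three inequalities hold: $$2\lambda_1^2 + 2\lambda_2^2 - 3 + \lambda_1^4 - 2\lambda_1^2\lambda_2^2 + \lambda_2^4 \geq 0,$$ $$2\lambda_1^2 - 3\lambda_1^4 + 2\lambda_1^2\lambda_2^2 - 2\lambda_2^2 + 1 + \lambda_2^4 \geq 0,$$ $$2\lambda_2^2 - 3\lambda_2^4 + 2\lambda_1^2\lambda_2^2 - 2\lambda_1^2 + 1 + \lambda_1^4 \geq 0.$$
   Context: The Lie algebra $\mathfrak{so}(3)$ of $SO(3)$ carries the bi-invariant inner product $\langle A,B\rangle_0=\tfrac12\,\mathrm{trace}(AB^T)$. If $g_l$ is a left-invariant Riemannian metric on $SO(3)$ with value $\langle\cdot,\cdot\rangle_l$ at the identity, there is a unique positive-definite $\langle\cdot,\cdot\rangle_0$-self-adjoint linear map $\phi:\mathfrak{so}(3)\to\mathfrak{so}(3)$ with $\langle A,B\rangle_l=\langle\phi(A),B\rangle_0$ for all $A,B$. The eigenvalues of $g_l$ are the eigenvalues of $\phi$, counted with multiplicity; there are three of them, all positive. *)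

(* Defs.v *)
From HB Require Import structures.
From mathcomp Require Import all_boot all_order all_algebra.
From mathcomp Require Import all_classical all_reals all_analysis.

Set Implicit Arguments.
Unset Strict Implicit.
Unset Printing Implicit Defensive.

Import Order.TTheory GRing.Theory Num.Theory numFieldNormedType.Exports.

Local Open Scope classical_set_scope.
Local Open Scope ring_scope.

Section Smooth.
Context (R : realType) (V W : normedModType R).

(* For finite-dimensional V: f is C^(k+1) iff it is Frechet differentiable and
   all its directional derivatives are C^k. *)
Fixpoint Ck (k : nat) (f : V -> W) : Prop :=
  match k with
  | 0%N => continuous f
  | k'.+1 => (forall x, differentiable f x) /\
             forall v, Ck k' (fun x => 'D_v f x)
  end.

Definition smooth (f : V -> W) : Prop := forall k, Ck k f.

End Smooth.

Section SO3.
Context (R : realType).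

Definition SO3 : Type :=
  {p : 'M[R]_3 | (p^T *m p == 1%:M) && (\det p == 1)}.

Fact SO3_one_subproof :
  ((1%:M : 'M[R]_3)^T *m 1%:M == 1%:M) && (\det (1%:M : 'M[R]_3) == 1).
Proof. by rewrite trmx1 mulmx1 det1 !eqxx. Qed.

Definition SO3_one : SO3 := Sub 1%:M SO3_one_subproof.

Fact SO3_mul_subproof (p q : SO3) :
  ((val p *m val q)^T *m (val p *m val q) == 1%:M) &&
  (\det (val p *m val q) == 1).
Proof.
case: p q => [p /andP[/eqP pp /eqP dp]] [q /andP[/eqP qq /eqP dq]] /=.
by rewrite trmx_mul mulmxA -(mulmxA q^T) pp mulmx1 qq det_mulmx dp dq mulr1
           !eqxx.
Qed.

Definition SO3_mul (p q : SO3) : SO3 := Sub (val p *m val q) (SO3_mul_subproof p q).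

Definition so3 (A : 'M[R]_3) : Prop := A^T = - A.

(* T_p SO(3) = p so(3), as a subspace of the space of 3 x 3 matrices. *)
Definition tangent (p : SO3) (v : 'M[R]_3) : Prop := so3 ((val p)^T *m v).

(* SO(3) is a closed submanifold of the space of matrices, so that smooth
   functions on it are the restrictions of smooth functions of matrices. *)
Definition smooth_extension (W : normedModType R) (f : SO3 -> W) :
    set ('M[R]_3 -> W) :=
  [set F | smooth F /\ forall p, F (val p) = f p].

Definition smoothSO3 (W : normedModType R) (f : SO3 -> W) : Prop :=
  smooth_extension f !=set0.

(* The differential df_p(v).  For f smooth and v tangent at p, the value does
   not depend on the extension of f selected by xget. *)
Definition tderive (W : normedModType R) (f : SO3 -> W) (p : SO3)
    (v : 'M[R]_3) : W :=
  'D_v (xget (fun=> 0) (smooth_extension f)) (val p).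

Definition vfield (X : SO3 -> 'M[R]_3) : Prop :=
  smoothSO3 X /\ forall p, tangent p (X p).

(* The vector field corresponding to the derivation f |-> X(Yf) - Y(Xf), in the
   coordinates of the ambient space of matrices. *)
Definition bracket (X Y : SO3 -> 'M[R]_3) : SO3 -> 'M[R]_3 :=
  fun p => tderive Y p (X p) - tderive X p (Y p).

Definition metric_field : Type := SO3 -> 'M[R]_3 -> 'M[R]_3 -> R.

(* m p is meaningful on T_p SO(3) only. *)
Definition riemannian_metric (m : metric_field) : Prop :=
  [/\ forall p (a : R) u v w, tangent p u -> tangent p v -> tangent p w ->
        m p (a *: u + v) w = a * m p u w + m p v w,
      forall p u v, tangent p u -> tangent p v -> m p u v = m p v u,
      forall p u, tangent p u -> u != 0 -> 0 < m p u u
    & forall X Y, vfield X -> vfield Y ->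
        smoothSO3 (fun p => m p (X p) (Y p))].

Definition left_invariant (m : metric_field) : Prop :=
  forall p q u v, tangent q u -> tangent q v ->
    m (SO3_mul p q) (val p *m u) (val p *m v) = m q u v.

Definition connection : Type :=
  (SO3 -> 'M[R]_3) -> (SO3 -> 'M[R]_3) -> SO3 -> 'M[R]_3.

Definition affine_connection (nabla : connection) : Prop :=
  [/\ forall X Y, vfield X -> vfield Y -> vfield (nabla X Y),
      forall (f : SO3 -> R) X X' Y,
        smoothSO3 f -> vfield X -> vfield X' -> vfield Y ->
        forall p, nabla (fun q => f q *: X q + X' q) Y p =
                  f p *: nabla X Y p + nabla X' Y p,
      forall X Y Y', vfield X -> vfield Y -> vfield Y' ->
        forall p, nabla X (fun q => Y q + Y' q) p =
                  nabla X Y p + nabla X Y' p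
    & forall (f : SO3 -> R) X Y, smoothSO3 f -> vfield X -> vfield Y ->
        forall p, nabla X (fun q => f q *: Y q) p =
                  tderive f p (X p) *: Y p + f p *: nabla X Y p].

Definition torsion_free (nabla : connection) : Prop :=
  forall X Y, vfield X -> vfield Y ->
    forall p, nabla X Y p - nabla Y X p = bracket X Y p.

Definition metric_compatible (m : metric_field) (nabla : connection) : Prop :=
  forall X Y Z, vfield X -> vfield Y -> vfield Z ->
    forall p, tderive (fun q => m q (Y q) (Z q)) p (X p) =
              m p (nabla X Y p) (Z p) + m p (Y p) (nabla X Z p).

Definition levi_civita (m : metric_field) (nabla : connection) : Prop :=
  [/\ affine_connection nabla, torsion_free nabla & metric_compatible m nabla].

Definition curvature (nabla : connection) (X Y Z : SO3 -> 'M[R]_3) :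
    SO3 -> 'M[R]_3 :=
  fun p => nabla X (nabla Y Z) p - nabla Y (nabla X Z) p
           - nabla (bracket X Y) Z p.

(* Sectional curvature at p of the plane spanned by X p and Y p. *)
Definition sectional_curvature (m : metric_field) (nabla : connection)
    (X Y : SO3 -> 'M[R]_3) (p : SO3) : R :=
  m p (curvature nabla X Y Y p) (X p) /
  (m p (X p) (X p) * m p (Y p) (Y p) - m p (X p) (Y p) ^+ 2).

(* The Levi-Civita connection of m exists and is unique on vector fields, so
   that the existential quantifier only names it. *)
Definition nonneg_sectional_curvature (m : metric_field) : Prop :=
  exists2 nabla, levi_civita m nabla &
    forall X Y p, vfield X -> vfield Y -> free [:: X p; Y p] ->
      0 <= sectional_curvature m nabla X Y p.

Definition ip0 (A B : 'M[R]_3) : R := 2^-1 * \tr (A *m B^T).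

Definition metric_operator (m : metric_field) (phi : 'M[R]_3 -> 'M[R]_3) :
    Prop :=
  [/\ forall A, so3 A -> so3 (phi A),
      forall (a : R) A B, so3 A -> so3 B ->
        phi (a *: A + B) = a *: phi A + phi B,
      forall A B, so3 A -> so3 B -> ip0 (phi A) B = ip0 A (phi B),
      forall A, so3 A -> A != 0 -> 0 < ip0 (phi A) A
    & forall A B, so3 A -> so3 B -> m SO3_one A B = ip0 (phi A) B].

(* The standard basis of so(3): infinitesimal rotations about the coordinate
   axes.  Indices are added modulo 3. *)
Definition so3_basis (k : 'I_3) : 'M[R]_3 :=
  delta_mx (k + 2%:R) (k + 1) - delta_mx (k + 1) (k + 2%:R).

(* s lists the eigenvalues, with multiplicity, of the operator phi associated
   with m; M is the matrix of phi in the basis so3_basis. *)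
Definition metric_eigenvalues (m : metric_field) (s : seq R) : Prop :=
  exists (phi : 'M[R]_3 -> 'M[R]_3) (M : 'M[R]_3),
    [/\ metric_operator m phi,
        forall i, phi (so3_basis i) = \sum_j M j i *: so3_basis j
      & char_poly M = \prod_(a <- s) ('X - a%:P)].

End SO3.

(* Main.v *)
(* A left-invariant metric on SO(3) admits a left-invariant frame E_k(p) = p e_k,
   with [e_k, e_(k+1)] = e_(k+2) and indices modulo 3, that is orthogonal with
   m(E_k, E_k) = mu_k, obtained by diagonalizing phi.  In this frame the
   Levi-Civita connection is given by
     mu_k (nabla_X Y)_k =
       mu_k X(y_k) + s_(k+1) x_(k+1) y_(k+2) - s_(k+2) x_(k+2) y_(k+1),
   where 2 s_k = mu_(k+1) + mu_(k+2) - mu_k, and its curvature is diagonal: with w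
   the cross product of the components of X and Y,
     m(R(X, Y) Y, X) = sum_k kappa_k w_k^2,
     kappa_k = s_k - s_(k+1) s_(k+2) / mu_k.
   Hence the sectional curvature is nonnegative iff the three kappa_k are, and
   4 mu_k kappa_k are the three polynomials of the theorem (Milnor).  Computing
   the curvature on arbitrary vector fields needs [D_i, D_(i+1)] = D_(i+2) for the
   derivatives along the frame, hence the symmetry of second derivatives. *)

Require Import Defs.
From mathcomp Require Import all_boot all_order all_algebra.
From mathcomp Require Import all_classical all_reals all_analysis.
From mathcomp Require Import ring lra.

Set Implicit Arguments.
Unset Strict Implicit.
Unset Printing Implicit Defensive.

Import Order.TTheory GRing.Theory Num.Theory numFieldNormedType.Exports.

Local Open Scope classical_set_scope.
Local Open Scope ring_scope.

(** * Calculus of smooth functions *)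

Section SmoothCalculus.
Context (R : realType) (V : normedModType R).

(** [tderive] differentiates an extension chosen arbitrarily, so nothing can be computed before its
    value is known to be independent of the choice. This holds because every tangent vector is the
    velocity of a curve that stays on SO(3). Cayley transforms supply these curves: they are
    rational in the parameter, so their derivatives are elementary. Once vector fields are replaced
    by their component functions, the geometric claims become polynomial identities in which the
    components and their frame derivatives at a point are free variables. The quantifier over
    connections in [nonneg_sectional_curvature] makes the necessity of the inequalities rest on
    uniqueness of the Levi-Civita connection. Each kappa_k can then be tested alone, since the plane
    of E_(k+1) and E_(k+2) has as w the k-th unit vector. Diagonalization only yields an orthogonal
    matrix, whose determinant may be -1, and then the frame would satisfy the bracket relations with
    the opposite sign. Dimension three being odd, negating the matrix repairs this. *)

Lemma CkS (W : normedModType R) k (f : V -> W) : Ck k.+1 f -> Ck k f.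
Proof.
elim: k f => [|k IHk] f [df Df]; first by move=> x; exact: differentiable_continuous.
by split=> // v; exact: IHk.
Qed.

Lemma smooth_differentiable (W : normedModType R) (f : V -> W) x :
  smooth f -> differentiable f x.
Proof. by move=> /(_ 1%N)[]. Qed.

Lemma smooth_continuous (W : normedModType R) (f : V -> W) :
  smooth f -> continuous f.
Proof. by move=> /(_ 0%N). Qed.

Lemma smooth_derivable (W : normedModType R) (f : V -> W) x v :
  smooth f -> derivable f x v.
Proof. by move=> sf; exact/diff_derivable/smooth_differentiable. Qed.

Lemma smooth_derive (W : normedModType R) (f : V -> W) v :
  smooth f -> smooth (fun x => 'D_v f x).
Proof. by move=> sf k; have [_] := sf k.+1; exact. Qed.

Lemma smooth_cst (W : normedModType R) (w : W) : smooth (fun _ : V => w).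
Proof.
move=> k; elim: k w => [|k IHk] w; first exact: cst_continuous.
split=> [x|v]; first exact: differentiable_cst.
rewrite (_ : (fun x => 'D__ _ x) = fun=> 0); first exact: IHk.
by apply: funext => x; exact: derive_cst.
Qed.

Lemma smooth_id : smooth (@id V).
Proof.
case=> [|k]; first by move=> x; exact: cvg_id.
split=> [x|v]; first by case: (is_diff_id x).
rewrite (_ : (fun x => 'D__ _ x) = fun=> v); first exact: smooth_cst.
by apply: funext => x; exact: derive_id.
Qed.

Lemma CkD (W : normedModType R) k (f g : V -> W) :
  Ck k f -> Ck k g -> Ck k (fun x => f x + g x).
Proof.
elim: k f g => [|k IHk] f g.
  by move=> cf cg x; apply: cvgD; [exact: cf|exact: cg].
move=> [df Df] [dg Dg]; split=> [x|v]; first exact: differentiableD.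
rewrite (_ : (fun x => 'D__ _ x) = fun x => 'D_v f x + 'D_v g x).
  by apply: IHk; [exact: Df|exact: Dg].
by apply: funext => x; rewrite deriveD//; exact: diff_derivable.
Qed.

Lemma smoothD (W : normedModType R) (f g : V -> W) :
  smooth f -> smooth g -> smooth (fun x => f x + g x).
Proof. by move=> sf sg k; exact: CkD. Qed.

Lemma smoothM (f g : V -> R) :
  smooth f -> smooth g -> smooth (fun x => f x * g x).
Proof.
move=> sf sg k; move: (sf k) (sg k).
elim: k f g {sf sg} => [|k IHk] f g.
  by move=> cf cg x; apply: cvgM; [exact: cf|exact: cg].
move=> cf cg; have [df Df] := cf; have [dg Dg] := cg.
split=> [x|v]; first exact: differentiableM.
rewrite (_ : (fun x => 'D__ _ x) = fun x => f x * 'D_v g x + g x * 'D_v f x); last first.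
  by apply: funext => x; rewrite deriveM//; exact: diff_derivable.
(* The product rule keeps one factor undifferentiated; [CkS] lowers its order to [k]. *)
by apply: CkD; apply: IHk; [exact: CkS|exact: Dg|exact: CkS|exact: Df].
Qed.

Lemma deriveZl (W : normedModType R) (f : V -> R) (w : W) x v :
  differentiable f x -> 'D_v (fun y => f y *: w) x = 'D_v f x *: w.
Proof.
move=> df; rewrite !deriveE//; last exact: differentiableZl.
by rewrite diffZl.
Qed.

Lemma smoothZl (W : normedModType R) (f : V -> R) (w : W) :
  smooth f -> smooth (fun x => f x *: w).
Proof.
move=> sf k; move: (sf k); elim: k f {sf} => [|k IHk] f.
  by move=> cf x; apply: cvgZr_tmp; exact: cf.
move=> [df Df]; split=> [x|v]; first exact: differentiableZl.
rewrite (_ : (fun x => 'D__ _ x) = fun x => 'D_v f x *: w); first exact/IHk/Df.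
by apply: funext => x; rewrite deriveZl.
Qed.

Lemma smooth_sum (W : normedModType R) (I : finType) (f : I -> V -> W) :
  (forall i, smooth (f i)) -> smooth (fun x => \sum_i f i x).
Proof.
move=> sf; elim: (index_enum I) => [|i s IHs].
  rewrite (_ : (fun x => \sum_(i <- [::]) f i x) = fun=> 0); first exact: smooth_cst.
  by apply: funext => x; rewrite big_nil.
rewrite (_ : (fun x => \sum_(i <- i :: s) f i x) =
  fun x => f i x + \sum_(i <- s) f i x); first exact: smoothD.
by apply: funext => x; rewrite big_cons.
Qed.

Lemma derive_sum_fin (W : normedModType R) (I : finType) (f : I -> V -> W) x v :
  (forall i, derivable (f i) x v) ->
  'D_v (fun y => \sum_i f i y) x = \sum_i 'D_v (f i) x.
Proof.
(* Derivability and value go through the induction together, since [deriveD] asks for derivability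
   of the tail. *)
move=> df; suff [] : derivable (fun y => \sum_i f i y) x v /\
  'D_v (fun y => \sum_i f i y) x = \sum_i 'D_v (f i) x by [].
elim: (index_enum I) => [|i s [ds Ds]].
  rewrite big_nil (_ : (fun y => \sum_(i <- [::]) f i y) = fun=> 0); last first.
    by apply: funext => y; rewrite big_nil.
  by split; [exact: derivable_cst|exact: derive_cst].
rewrite big_cons (_ : (fun y => \sum_(i <- i :: s) f i y) =
  f i + (fun y => \sum_(i <- s) f i y)); last first.
  by apply: funext => y; rewrite big_cons.
by split; [exact: derivableD|rewrite deriveD// Ds].
Qed.

Lemma derive_coord m n (F : V -> 'M[R]_(m, n)) x v i j :
  derivable F x v -> 'D_v (fun y => F y i j) x = ('D_v F x) i j.
Proof. by move=> dF; rewrite derive_mx// mxE. Qed.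

Lemma smooth_coord m n (F : V -> 'M[R]_(m, n)) i j :
  smooth F -> smooth (fun x => F x i j).
Proof.
move=> sF k; move: (sF k); elim: k F {sF} => [|k IHk] F.
  by move=> cF x; apply: (@continuous_comp _ _ _ F (fun M => M i j));
    [exact: cF|exact: coord_continuous].
move=> [dF DF]; split=> [x|v].
  by apply: (@differentiable_comp _ _ _ _ F (fun M => M i j));
    [exact: dF|exact: differentiable_coord].
rewrite (_ : (fun x => 'D__ _ x) = fun x => ('D_v F x) i j); first exact/IHk/DF.
by apply: funext => x; rewrite derive_coord//; exact: diff_derivable.
Qed.

End SmoothCalculus.

(** * Symmetry of second derivatives *)

Section SymmetricDerivative.
Context (R : realType) (V : normedModType R).

(** Chain rule along a line, which brings the one-variable mean value theorem to [V]. *)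
Lemma is_derive_line (g : V -> R) (y u : V) (r : R) :
  differentiable g (y + r *: u) ->
  is_derive r 1 (fun t : R => g (y + t *: u)) ('D_u g (y + r *: u)).
Proof.
move=> dg.
have dtu : differentiable (fun t : R => t *: u) r by exact: differentiableZl.
have dl : differentiable (fun t : R => y + t *: u) r by exact: differentiableD.
have dgl : differentiable (fun t : R => g (y + t *: u)) r.
  exact: (@differentiable_comp _ _ _ _ (fun t : R => y + t *: u) g).
apply: DeriveDef; first exact: diff_derivable.
rewrite !deriveE// (@diff_comp _ _ _ _ (fun t : R => y + t *: u) g)//=.
rewrite -[X in 'd g _ X]deriveE// deriveD ?derive_cst ?add0r//.
- by rewrite (@deriveZl _ _ _ id)// derive_id scale1r.
- exact: diff_derivable.
Qed.

Lemma derive_shift_pt (f : V -> R) (u w y : V) :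
  'D_u (fun z => f (z + w)) y = 'D_u f (y + w).
Proof.
apply: (f_equal (fun q : R -> R => lim (q @ 0^'))).
by apply: funext => h /=; rewrite addrA.
Qed.

Lemma MVT_line (g : V -> R) (y u : V) (s : R) :
  (forall z, differentiable g z) -> 0 < s ->
  exists2 c, 0 < c < s & g (y + s *: u) - g y = 'D_u g (y + c *: u) * s.
Proof.
move=> dg s0.
have dl (r : R) := @is_derive_line g y u r (dg _).
have [|c] := @MVT R (fun t : R => g (y + t *: u)) _ 0 s s0 (fun r _ => dl r).
  apply: continuous_subspaceT => r.
  by case: (dl r) => dlr _; apply/differentiable_continuous/derivable1_diffP.
rewrite in_itv /= scale0r addr0 subr0 => cs ->.
by exists c.
Qed.

(** Mean value theorem twice: along [u] for the increment of [f] by [s *: v], then along [v] for the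
    derivative of [f] in direction [u]. *)
Lemma second_difference (f : V -> R) (x u v : V) (s : R) : smooth f -> 0 < s ->
  exists c d, [/\ 0 < c < s, 0 < d < s &
    f (x + s *: u + s *: v) - f (x + s *: u) - (f (x + s *: v) - f x) =
    'D_v (fun y => 'D_u f y) (x + c *: u + d *: v) * s * s].
Proof.
move=> sf s0.
have df y := smooth_differentiable y sf.
have dfs y : differentiable (fun z => f (z + s *: v)) y.
  by apply: (@differentiable_comp _ _ _ _ (fun z : V => z + s *: v) f).
pose g := (fun z => f (z + s *: v)) - f.
have dg y : differentiable g y by exact: differentiableB.
have [c c0s gc] := MVT_line x u dg s0.
have dDf y := smooth_differentiable y (smooth_derive u sf).
have [d d0s fd] := MVT_line (x + c *: u) v dDf s0.
exists c, d; split=> //; rewrite -fd -derive_shift_pt.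
transitivity (g (x + s *: u) - g x); first by rewrite /g !fctE /=; ring.
by rewrite gc /g deriveB//; exact: diff_derivable.
Qed.

(** The values agree at two different points, because the mean value theorem gives different points
    for the two orders of differentiation; both points tend to [x] with [s]. *)
Lemma continuous_meet (g1 g2 : V -> R) (x u v : V) :
  {for x, continuous g1} -> {for x, continuous g2} ->
  (forall s : R, 0 < s -> exists c d c' d',
     [/\ 0 < c < s, 0 < d < s, 0 < c' < s & 0 < d' < s] /\
     g1 (x + c *: u + d *: v) = g2 (x + c' *: u + d' *: v)) ->
  g1 x = g2 x.
Proof.
move=> c1 c2 meet; apply/eqP; apply: contraT => ne.
pose e : R := `|g1 x - g2 x| / 2.
have e0 : 0 < e by rewrite divr_gt0// normr_gt0 subr_eq0.
have n1 : \forall y \near x, `|g1 x - g1 y| < e by move/cvgrPdist_lt: c1; exact.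
have n2 : \forall y \near x, `|g2 x - g2 y| < e by move/cvgrPdist_lt: c2; exact.
have : \forall y \near x, `|g1 x - g1 y| < e /\ `|g2 x - g2 y| < e.
  exact: filterI.
move=> /nbhs_ballP[r /= r0 near_r].
(* For [s = r / (|u| + |v| + 1)] both points lie in the ball; the [1] keeps the divisor positive
   when [u] and [v] vanish. *)
have N0 : 0 < `|u| + `|v| + 1 by rewrite ltr_wpDl// addr_ge0.
have [c [d [c' [d' [[cs ds cs' ds'] eq_g]]]]] := meet _ (divr_gt0 r0 N0).
set k := r / _ in cs ds cs' ds'.
have k0 : 0 < k by exact: divr_gt0.
have in_ball a b : 0 < a < k -> 0 < b < k -> ball x r (x + a *: u + b *: v).
  move=> /andP[a0 ak] /andP[b0 bk].
  rewrite -ball_normE /ball_ /= -addrA opprD addNKr normrN.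
  rewrite (le_lt_trans (ler_normD _ _))// !normrZ !gtr0_norm//.
  rewrite -[ltRHS](divfK (lt0r_neq0 N0)) -/k !mulrDr mulr1.
  rewrite (@le_lt_trans _ _ (k * `|u| + k * `|v|)) ?ltrDl//.
  by rewrite lerD// ler_wpM2r// ltW.
have [n1' _] := near_r _ (in_ball _ _ cs ds).
have [_ n2'] := near_r _ (in_ball _ _ cs' ds').
suff : `|g1 x - g2 x| < e + e by rewrite /e -splitr ltxx.
rewrite -(subrKA (g1 (x + c *: u + d *: v))) (le_lt_trans (ler_normD _ _))//.
by rewrite ltrD// distrC eq_g.
Qed.

(** The second difference over the parallelogram with sides [s *: u] and [s *: v] is symmetric in
    the two directions, and it is [s * s] times either mixed derivative at a nearby point. *)
Lemma derive_comm (f : V -> R) (u v x : V) : smooth f ->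
  'D_v (fun y => 'D_u f y) x = 'D_u (fun y => 'D_v f y) x.
Proof.
move=> sf; pose f_uv y := 'D_v (fun z => 'D_u f z) y.
pose f_vu y := 'D_u (fun z => 'D_v f z) y.
apply: (@continuous_meet f_uv f_vu x u v).
- exact: smooth_continuous (smooth_derive v (smooth_derive u sf)) x.
- exact: smooth_continuous (smooth_derive u (smooth_derive v sf)) x.
have swap (a b c d : R) : a - b - (c - d) = a - c - (b - d) by ring.
move=> s s0; have [c [d [cs ds fuv]]] := second_difference x u v sf s0.
have [d' [c' [ds' cs' fvu]]] := second_difference x v u sf s0.
have eq_uv : f_uv (x + c *: u + d *: v) * s * s =
    f_vu (x + d' *: v + c' *: u) * s * s.
  by apply: etrans (esym fuv) (etrans _ fvu); rewrite swap [x + s *: v + _]addrAC.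
exists c, d, c', d'; split; first by split.
have s_neq0 : s != 0 by rewrite gt_eqF.
rewrite [x + c' *: u + _]addrAC.
exact: (mulIf s_neq0 (mulIf s_neq0 eq_uv)).
Qed.

End SymmetricDerivative.

(** * Rotations through a point *)

Lemma ord3_ind (P : 'I_3 -> Prop) : P 0 -> P 1 -> P 2%:R -> forall i, P i.
Proof.
move=> P0 P1 P2 [[|[|[|//]]] lti].
- by rewrite (_ : Ordinal lti = 0)//; exact: val_inj.
- by rewrite (_ : Ordinal lti = 1)//; exact: val_inj.
- by rewrite (_ : Ordinal lti = 2%:R)//; exact: val_inj.
Qed.

Lemma sum3 (W : nmodType) (f : 'I_3 -> W) :
  \sum_i f i = f 0 + f 1 + f 2%:R.
Proof.
rewrite !big_ord_recr big_ord0 /= add0r.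
by congr (f _ + f _ + f _); exact: val_inj.
Qed.

Section Rotations.
Context (R : realType).
Implicit Types (A : 'M[R]_3) (p : SO3 R).

Lemma ip0E A (B : 'M[R]_3) : ip0 A B = 2^-1 * \sum_i \sum_j A i j * B i j.
Proof.
congr (_ * _); apply: eq_bigr => i _; rewrite mxE; apply: eq_bigr => j _.
by rewrite mxE.
Qed.

Lemma so3E A i j : so3 A -> A j i = - A i j.
Proof. by move=> /matrixP/(_ i j); rewrite !mxE. Qed.

Lemma so3_diag A i : so3 A -> A i i = 0.
Proof. by move=> /so3E - /(_ i i) Aii; lra. Qed.

(** Cayley-Hamilton: a skew [A] has characteristic polynomial X^3 + [ip0 A A] X. *)
Lemma so3_cube A : so3 A -> A *m A *m A = - ip0 A A *: A.
Proof.
move=> sA; have e01 := so3E 0 1 sA; have e02 := so3E 0 2%:R sA.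
have e12 := so3E 1 2%:R sA; have d := so3_diag _ sA.
apply/matrixP => i j; rewrite ip0E !mxE !sum3 !mxE !sum3 !d e01 e02 e12.
by elim/ord3_ind: i; elim/ord3_ind: j; rewrite ?d ?e01 ?e02 ?e12; field.
Qed.

(* By [so3_cube] these matrices are closed under products for skew [A]; they
   include the exponential and the Cayley transform of multiples of [A]. *)
Definition rodrigues A (a b : R) : 'M[R]_3 := 1%:M + a *: A + b *: (A *m A).

Lemma rodriguesM A (a b c d : R) : so3 A ->
  rodrigues A a b *m rodrigues A c d =
  rodrigues A (a + c - ip0 A A * (a * d + b * c))
              (b + d + a * c - ip0 A A * b * d).
Proof.
move=> sA; have A3 := so3_cube sA; have A3' : A *m (A *m A) = - ip0 A A *: A.
  by rewrite mulmxA.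
have A4 : A *m A *m (A *m A) = - ip0 A A *: (A *m A).
  by rewrite mulmxA A3 scalemxAl.
rewrite /rodrigues !mulmxDl !mulmxDr !mul1mx !mulmx1 -!scalemxAl -!scalemxAr.
rewrite A3 A3' A4; move: (ip0 A A) (A *m A) => n B.
by apply/matrixP => i j; rewrite !mxE; ring.
Qed.

Lemma tr_rodrigues A a b : so3 A -> (rodrigues A a b)^T = rodrigues A (- a) b.
Proof.
move=> sA; rewrite /rodrigues !linearD !linearZ /= trmx_mul trmx1.
by rewrite (sA : A^T = - A) mulNmx mulmxN opprK scaleNr scalerN.
Qed.

Lemma rodrigues0 A : rodrigues A 0 0 = 1%:M.
Proof. by rewrite /rodrigues !scale0r !addr0. Qed.

Lemma ip0_ge0 A : 0 <= ip0 A A.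
Proof.
rewrite ip0E mulr_ge0 ?invr_ge0//; apply: sumr_ge0 => i _.
by apply: sumr_ge0 => j _; rewrite -expr2 sqr_ge0.
Qed.

(** With B = (t / 2) A this is c = 1 / (1 + [ip0 B B]), the constant in (1 - B)^-1 = 1 + c (B +
    B^2). *)
Definition curve_scale A (t : R) : R := 4 * (4 + ip0 A A * (t * t))^-1.

(* The Cayley transform of [(t / 2) A]. *)
Definition curve A (t : R) : 'M[R]_3 :=
  rodrigues A (t * curve_scale A t) (t * (t * (2^-1 * curve_scale A t))).

Lemma curve_denom_gt0 A (t : R) : 0 < 4 + ip0 A A * (t * t).
Proof. by rewrite ltr_pwDl// mulr_ge0 ?ip0_ge0// -expr2 sqr_ge0. Qed.

Lemma curve_orthogonal A t : so3 A -> (curve A t)^T *m curve A t = 1%:M.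
Proof.
move=> sA; rewrite tr_rodrigues// rodriguesM// -(rodrigues0 A).
have := lt0r_neq0 (curve_denom_gt0 A t); rewrite /curve_scale.
move: (ip0 A A) => n n0; congr rodrigues; by field.
Qed.

(** With B = (t / 2) A, the curve C satisfies C (1 - B) = 1 + B = (1 - B)^T, and 1 - B has the same
    nonzero determinant as its transpose. *)
Lemma det_curve A t : so3 A -> \det (curve A t) = 1.
Proof.
move=> sA; pose D (s : R) := rodrigues A s 0.
have CD : curve A t *m D (- (t / 2)) = D (t / 2).
  rewrite rodriguesM//; have := lt0r_neq0 (curve_denom_gt0 A t).
  by rewrite /curve_scale; move: (ip0 A A) => n n0; congr rodrigues; field.
have trD : (D (t / 2))^T = D (- (t / 2)) by rewrite tr_rodrigues.
(* The inverse of 1 - B is (1 + C) / 2, because (1 + C) (1 - B) = (1 - B) + (1 + B) = 2. *)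
have Dunit : D (- (t / 2)) \in unitmx.
  suff /mulmx1_unit[] : (2^-1 *: (1%:M + curve A t)) *m D (- (t / 2)) = 1%:M by [].
  rewrite -scalemxAl mulmxDl CD mul1mx /D /rodrigues.
  by apply/matrixP => i j; rewrite !mxE; field.
have /(congr1 determinant) := CD; rewrite det_mulmx -[D (t / 2)]trmxK det_tr trD.
by rewrite -[RHS]mul1r => /mulIf; apply; rewrite -unitfE -unitmxE.
Qed.

Lemma curve_SO3 p A t : so3 A -> exists q : SO3 R, val q = val p *m curve A t.
Proof.
move=> sA; have oC := curve_orthogonal t sA; have dC := det_curve t sA.
have C1 : ((curve A t)^T *m curve A t == 1%:M) && (\det (curve A t) == 1).
  by rewrite oC dC !eqxx.
by exists (SO3_mul p (Sub (curve A t) C1)).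
Qed.

Lemma SO3_trV p : (val p)^T *m val p = 1%:M.
Proof. by case: p => p /= /andP[/eqP]. Qed.

Lemma SO3_Vtr p : val p *m (val p)^T = 1%:M.
Proof. exact/mulmx1C/SO3_trV. Qed.

Lemma differentiable_curve_scale A (t : R) : differentiable (curve_scale A) t.
Proof.
apply: differentiableM => //; apply: differentiableV; last first.
  by rewrite gt_eqF// curve_denom_gt0.
by apply: differentiableD => //; apply: differentiableM.
Qed.

(** Both coefficients of [curve] carry a factor [t], so their derivatives at 0 are the values of the
    cofactors there, namely 1 and 0. *)
Lemma derive_id_mul (g : R -> R) : differentiable g 0 ->
  differentiable (fun t : R => t * g t) 0 /\ 'D_1 (fun t : R => t * g t) 0 = g 0.
Proof.
move=> dg; have did : differentiable (@id R) 0 by case: (is_diff_id (0 : R)).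
split; first exact: (differentiableM did dg).
rewrite (@deriveM _ _ id g 0 1 (diff_derivable did) (diff_derivable dg)).
by rewrite derive_id scale0r add0r; exact: mulr1.
Qed.

Lemma is_derive_curve p A :
  is_derive (0 : R) 1 (fun t : R => val p *m curve A t) (val p *m A).
Proof.
have dK := differentiable_curve_scale A 0.
have [da Da] := derive_id_mul dK.
have [|db Db] := @derive_id_mul (fun t => t * (2^-1 * curve_scale A t)).
  have dhK : differentiable (fun t : R => 2^-1 * curve_scale A t) 0.
    exact: (differentiableM (differentiable_cst _ _) dK).
  by have [] := derive_id_mul dhK.
set a := fun t => _ in da Da; set b := fun t => _ in db Db.
rewrite (_ : (fun t => _) = fun t =>
  val p + a t *: (val p *m A) + b t *: (val p *m (A *m A))); last first.
  by apply: funext => t; rewrite /curve /rodrigues !mulmxDr mulmx1 -!scalemxAr.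
have dA : differentiable (fun t => a t *: (val p *m A)) 0 by exact: differentiableZl.
have dB : differentiable (fun t => b t *: (val p *m (A *m A))) 0.
  exact: differentiableZl.
have dp : differentiable (fun _ : R => val p) 0 by exact: differentiable_cst.
have dpA : differentiable (fun t => val p + a t *: (val p *m A)) 0.
  exact: differentiableD.
apply: DeriveDef; first by apply/derivable1_diffP; exact: differentiableD.
rewrite deriveD; [|exact: diff_derivable..].
rewrite deriveD; [|exact: diff_derivable..].
rewrite !deriveZl// derive_cst add0r Da Db mul0r scale0r addr0.
by rewrite /curve_scale !mulr0 addr0 divff ?scale1r// gt_eqF.
Qed.

Lemma tangent_curve p v : tangent p v ->
  exists c : R -> 'M[R]_3, [/\ differentiable c 0, 'D_1 c 0 = v, c 0 = val p
    & forall t, exists q : SO3 R, val q = c t].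
Proof.
move=> tv; have := is_derive_curve p ((val p)^T *m v).
rewrite mulmxA SO3_Vtr mul1mx => -[dc Dc].
exists (fun t => val p *m curve ((val p)^T *m v) t).
split=> [||| t]; [exact/derivable1_diffP|exact: Dc| |exact: curve_SO3].
by rewrite /curve !mul0r rodrigues0 mulmx1.
Qed.

(** Both derivatives are derivatives along one curve on SO(3) with velocity [v], where the two
    functions coincide. This makes [tderive] well defined. *)
Lemma derive_ext_eq (W : normedModType R) (F G : 'M[R]_3 -> W) p v :
  (forall x, differentiable F x) -> (forall x, differentiable G x) ->
  (forall q : SO3 R, F (val q) = G (val q)) -> tangent p v ->
  'D_v F (val p) = 'D_v G (val p).
Proof.
move=> dF dG FG /tangent_curve[c [dc Dc c0 cq]].
have chain (H : 'M[R]_3 -> W) : (forall x, differentiable H x) ->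
    'D_v H (val p) = 'D_1 (H \o c) 0.
  move=> dH; rewrite (deriveE _ (dH _)) -c0 -Dc !deriveE//.
    by rewrite (diff_comp dc (dH _)).
  exact: differentiable_comp.
rewrite !chain// (_ : F \o c = G \o c)//; apply: funext => t /=.
by have [q <-] := cq t.
Qed.

Lemma tderiveE (W : normedModType R) (f : SO3 R -> W) F p v :
  smooth_extension f F -> tangent p v -> tderive f p v = 'D_v F (val p).
Proof.
move=> [sF Ff] tv; rewrite /tderive; case: xgetP => [G _ [sG Gf]|/(_ F)]; last by case.
apply: derive_ext_eq => // [x|x|q]; [exact: smooth_differentiable..|].
by rewrite Gf Ff.
Qed.

End Rotations.

(** * Smooth functions on SO(3) *)

Section SO3Calculus.
Context (R : realType).
Implicit Types (p : SO3 R) (f g : SO3 R -> R).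

(** Linearity of the differential; it turns a direction that varies with the point into smooth
    coefficients times derivatives in fixed directions. *)
Lemma derive_dirE (F : 'M[R]_3 -> R) (x M : 'M[R]_3) : smooth F ->
  'D_M F x = \sum_i \sum_j M i j * 'D_(delta_mx i j) F x.
Proof.
move=> sF; have dF := smooth_differentiable x sF.
rewrite deriveE// [in LHS](matrix_sum_delta M) linear_sum.
apply: eq_bigr => i _; rewrite linear_sum; apply: eq_bigr => j _.
by rewrite linearZ deriveE.
Qed.

Lemma smooth_mulmx_coord (M : 'M[R]_3) i j :
  smooth (fun q : 'M[R]_3 => (q *m M) i j).
Proof.
rewrite (_ : (fun q => _) = fun q : 'M[R]_3 => \sum_k q i k * M k j); last first.
  by apply: funext => q; rewrite mxE.
apply: smooth_sum => k; apply: smoothM; last exact: smooth_cst.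
exact: smooth_coord (smooth_id _).
Qed.

Lemma derive_mulmx_coord (M x u : 'M[R]_3) i j :
  'D_u (fun q : 'M[R]_3 => (q *m M) i j) x = (u *m M) i j.
Proof.
rewrite (_ : (fun q => _) = fun q : 'M[R]_3 => \sum_k q i k * M k j); last first.
  by apply: funext => q; rewrite mxE.
have sq k := smooth_coord i k (smooth_id 'M[R]_3).
rewrite derive_sum_fin => [|k]; last first.
  by apply: derivableM; [exact: smooth_derivable|exact: derivable_cst].
rewrite mxE; apply: eq_bigr => k _.
have dk : derivable (fun q : 'M[R]_3 => q i k) x u by exact: smooth_derivable.
rewrite (deriveM dk (derivable_cst _ _ _)) derive_cst scaler0 add0r.
by rewrite derive_coord ?derive_id; [exact: mulrC|exact: derivable_id].
Qed.

Lemma scale_translateE (C : 'M[R]_3 -> R) (M : 'M[R]_3) :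
  (fun x => C x *: (x *m M)) =
  fun x => \sum_i \sum_j (C x * (x *m M) i j) *: delta_mx i j.
Proof.
apply: funext => x; rewrite [in LHS](matrix_sum_delta (x *m M)) scaler_sumr.
apply: eq_bigr => i _; rewrite scaler_sumr; apply: eq_bigr => j _.
exact: scalerA.
Qed.

Lemma smooth_scale_translate (C : 'M[R]_3 -> R) (M : 'M[R]_3) : smooth C ->
  smooth (fun x => C x *: (x *m M)).
Proof.
move=> sC; rewrite scale_translateE; apply: smooth_sum => i; apply: smooth_sum => j.
by apply: smoothZl; apply: smoothM => //; exact: smooth_mulmx_coord.
Qed.

Lemma derive_scale_translate (C : 'M[R]_3 -> R) (M x u : 'M[R]_3) : smooth C ->
  'D_u (fun x => C x *: (x *m M)) x = 'D_u C x *: (x *m M) + C x *: (u *m M).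
Proof.
move=> sC; apply/matrixP => i j.
have sCM := smooth_scale_translate M sC.
rewrite -(derive_coord _ _ (smooth_derivable sCM)).
rewrite (_ : (fun y => _) = fun y => C y * (y *m M) i j); last first.
  by apply: funext => y; rewrite mxE.
have sM := smooth_mulmx_coord M i j.
rewrite (deriveM (smooth_derivable sC) (smooth_derivable sM)).
rewrite derive_mulmx_coord !mxE addrC; congr (_ + _); exact: mulrC.
Qed.

Lemma smooth_moving_derive (F : 'M[R]_3 -> R) (M : 'M[R]_3) : smooth F ->
  smooth (fun q => 'D_(q *m M) F q).
Proof.
move=> sF; rewrite (_ : (fun q => _) = fun q =>
  \sum_i \sum_j (q *m M) i j * 'D_(delta_mx i j) F q); last first.
  by apply: funext => q; rewrite derive_dirE.
apply: smooth_sum => i; apply: smooth_sum => j; apply: smoothM.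
  exact: smooth_mulmx_coord.
exact: smooth_derive.
Qed.

(** Product rule for the differential of [F] paired with the direction [q *m M]; [derive_comm] moves
    [u] to the inner derivative. *)
Lemma derive_moving_derive (F : 'M[R]_3 -> R) (M x u : 'M[R]_3) : smooth F ->
  'D_u (fun q => 'D_(q *m M) F q) x =
  'D_(u *m M) F x + 'D_(x *m M) (fun q => 'D_u F q) x.
Proof.
move=> sF; rewrite (_ : (fun q => 'D_(q *m M) F q) = fun q =>
  \sum_i \sum_j (q *m M) i j * 'D_(delta_mx i j) F q); last first.
  by apply: funext => q; rewrite derive_dirE.
have sM i j := smooth_mulmx_coord M i j.
have sD i j := smooth_derive (delta_mx i j) sF.
rewrite derive_sum_fin => [|i]; last first.
  apply: smooth_derivable; apply: smooth_sum => j; exact: smoothM.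
rewrite derive_dirE// derive_dirE; last exact: smooth_derive.
rewrite -big_split; apply: eq_bigr => i _ /=.
rewrite derive_sum_fin => [|j]; last by apply: smooth_derivable; exact: smoothM.
rewrite -big_split; apply: eq_bigr => j _ /=.
rewrite (deriveM (smooth_derivable (sM i j)) (smooth_derivable (sD i j))).
rewrite addrC derive_mulmx_coord (derive_comm _ u _ sF); congr (_ + _).
exact: mulrC.
Qed.

Lemma tderive_add (W : normedModType R) (f g : SO3 R -> W) p v :
  smoothSO3 f -> smoothSO3 g -> tangent p v ->
  tderive (fun q => f q + g q) p v = tderive f p v + tderive g p v.
Proof.
move=> [F [sF Ff]] [G [sG Gg]] tv.
rewrite (@tderiveE _ _ f F)// (@tderiveE _ _ g G)//.
rewrite (@tderiveE _ _ _ (fun x => F x + G x))//.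
  by rewrite deriveD//; exact: smooth_derivable.
by split=> [|q]; [exact: smoothD|rewrite Ff Gg].
Qed.

Lemma tderive_mul f g p v : smoothSO3 f -> smoothSO3 g -> tangent p v ->
  tderive (fun q => f q * g q) p v = f p * tderive g p v + g p * tderive f p v.
Proof.
move=> [F [sF Ff]] [G [sG Gg]] tv.
rewrite (@tderiveE _ _ f F)// (@tderiveE _ _ g G)//.
rewrite (@tderiveE _ _ _ (fun x => F x * G x))//.
  rewrite (deriveM (smooth_derivable sF) (smooth_derivable sG)).
  by rewrite Ff Gg.
by split=> [|q]; [exact: smoothM|rewrite Ff Gg].
Qed.

Lemma smoothSO3_cst (W : normedModType R) (w : W) : smoothSO3 (fun _ : SO3 R => w).
Proof. by exists (fun=> w); split=> //; exact: smooth_cst. Qed.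

Lemma smoothSO3_add (W : normedModType R) (f g : SO3 R -> W) :
  smoothSO3 f -> smoothSO3 g -> smoothSO3 (fun q => f q + g q).
Proof.
move=> [F [sF Ff]] [G [sG Gg]]; exists (fun x => F x + G x).
by split=> [|q]; [exact: smoothD|rewrite Ff Gg].
Qed.

Lemma smoothSO3_mul f g :
  smoothSO3 f -> smoothSO3 g -> smoothSO3 (fun q => f q * g q).
Proof.
move=> [F [sF Ff]] [G [sG Gg]]; exists (fun x => F x * G x).
by split=> [|q]; [exact: smoothM|rewrite Ff Gg].
Qed.

Lemma smoothSO3_sub f g :
  smoothSO3 f -> smoothSO3 g -> smoothSO3 (fun q => f q - g q).
Proof.
move=> sf sg; rewrite (_ : (fun q => _) = fun q => f q + (- 1) * g q).
  by apply: smoothSO3_add => //; apply: smoothSO3_mul => //; exact: smoothSO3_cst.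
by apply: funext => q; rewrite mulN1r.
Qed.

Lemma smoothSO3_sum (W : normedModType R) (I : finType) (f : I -> SO3 R -> W) :
  (forall i, smoothSO3 (f i)) -> smoothSO3 (fun q => \sum_i f i q).
Proof.
move=> sf; have [F Ff] := choice sf; exists (fun x => \sum_i F i x).
split=> [|q]; first by apply: smooth_sum => i; case: (Ff i).
by apply: eq_bigr => i _; case: (Ff i).
Qed.

Lemma tderive_sum (W : normedModType R) (I : finType) (f : I -> SO3 R -> W) p v :
  (forall i, smoothSO3 (f i)) -> tangent p v ->
  tderive (fun q => \sum_i f i q) p v = \sum_i tderive (f i) p v.
Proof.
move=> sf tv; have [F Ff] := choice sf.
rewrite (@tderiveE _ _ _ (fun x => \sum_i F i x))//; last first.
  split=> [|q]; first by apply: smooth_sum => i; case: (Ff i).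
  by apply: eq_bigr => i _; case: (Ff i).
rewrite derive_sum_fin => [|i]; last by apply: smooth_derivable; case: (Ff i).
by apply: eq_bigr => i _; rewrite (tderiveE (Ff i) tv).
Qed.

Lemma tderive_cst (W : normedModType R) (w : W) p v : tangent p v ->
  tderive (fun _ : SO3 R => w) p v = 0.
Proof.
move=> tv; rewrite (@tderiveE _ _ _ (fun=> w))//; first exact: derive_cst.
by split=> //; exact: smooth_cst.
Qed.

Lemma tangentD p (a : R) u v :
  tangent p u -> tangent p v -> tangent p (a *: u + v).
Proof.
rewrite /tangent /so3 mulmxDr -scalemxAr linearD linearZ /= => -> ->.
by rewrite scalerN opprD.
Qed.

Lemma tangent_sum p (I : finType) (v : I -> 'M[R]_3) :
  (forall i, tangent p (v i)) -> tangent p (\sum_i v i).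
Proof.
move=> tv; elim/big_ind : _ => // [|u w tu tw].
  by rewrite /tangent /so3 mulmx0 linear0 oppr0.
by rewrite -[u]scale1r; exact: tangentD.
Qed.

Lemma tangentZ p (a : R) u : tangent p u -> tangent p (a *: u).
Proof.
by rewrite /tangent /so3 -scalemxAr linearZ /= => ->; rewrite scalerN.
Qed.

Lemma tangent_left_translate p (A : 'M[R]_3) : so3 A -> tangent p (val p *m A).
Proof. by rewrite /tangent mulmxA SO3_trV mul1mx. Qed.

Definition left_derive (A : 'M[R]_3) (f : SO3 R -> R) : SO3 R -> R :=
  fun p => tderive f p (val p *m A).

Lemma left_derive_extension A f F : so3 A -> smooth_extension f F ->
  smooth_extension (left_derive A f) (fun q => 'D_(q *m A) F q).
Proof.
move=> sA Ff; split=> [|p]; first by apply: smooth_moving_derive; case: Ff.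
by rewrite /left_derive (tderiveE Ff (tangent_left_translate p sA)).
Qed.

Lemma smoothSO3_left_derive A f : so3 A -> smoothSO3 f -> smoothSO3 (left_derive A f).
Proof. by move=> sA [F Ff]; eexists; exact: (left_derive_extension sA Ff). Qed.

(** The second-order terms cancel by symmetry of second derivatives; what survives comes from the
    variation of the directions [q *m A] and [q *m B]. *)
Lemma left_derive_commutator A B f p : so3 A -> so3 B -> smoothSO3 f ->
  so3 (A *m B - B *m A) ->
  left_derive A (left_derive B f) p - left_derive B (left_derive A f) p =
  left_derive (A *m B - B *m A) f p.
Proof.
move=> sA sB [F Ff] sC; have [sF _] := Ff.
have tA := tangent_left_translate p sA; have tB := tangent_left_translate p sB.
have -> := tderiveE (left_derive_extension sB Ff) tA : left_derive A _ p = _.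
have -> := tderiveE (left_derive_extension sA Ff) tB : left_derive B _ p = _.
have -> := tderiveE Ff (tangent_left_translate p sC) : left_derive _ f p = _.
have cancel_second (a b c d x y : R) :
  a = c + x -> b = d + y -> x = y -> a - b = c - d by move=> -> -> ->; ring.
have E1 := derive_moving_derive B (val p) (val p *m A) sF.
have E2 := derive_moving_derive A (val p) (val p *m B) sF.
have C := derive_comm (val p *m A) (val p *m B) (val p) sF.
apply: etrans (cancel_second _ _ _ _ _ _ E1 E2 C) _.
have dF := smooth_differentiable (val p) sF.
rewrite (deriveE _ dF) [X in _ - X](deriveE _ dF) [RHS](deriveE _ dF).
rewrite mulmxBr !mulmxA.
exact: (esym (linearB ('d F (val p)) _ _)).
Qed.

End SO3Calculus.

(** * Algebra of the curvature *)

(** Sums of indices modulo 3 in normal form, so that [ring] recognizes equal atoms after a case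
    split on the index. *)
Lemma ord3E :
  ((((0 : 'I_3) + 1)%R = 1) * (((1 : 'I_3) + 1)%R = 2%:R) *
   (((2%:R : 'I_3) + 1)%R = 0) * (((0 : 'I_3) + 2%:R)%R = 2%:R) *
   (((1 : 'I_3) + 2%:R)%R = 0) * (((2%:R : 'I_3) + 2%:R)%R = 1))%type.
Proof. by do !split; exact: val_inj. Qed.

Section CurvatureAlgebra.
Context (R : comPzRingType).
Implicit Types (x y z s nu : 'I_3 -> R) (k : 'I_3).

Definition cross x y k : R := x (k + 1) * y (k + 2%:R) - x (k + 2%:R) * y (k + 1).

(** The derivative-free part of the connection, with [nu] standing for the inverse of [mu] to avoid
    division. The sign sits in the coefficient so that both summands have the form a * (f * g). *)
Definition christoffel nu s x y k : R :=
  nu k * (s (k + 1) * (x (k + 1) * y (k + 2%:R)) +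
          - s (k + 2%:R) * (x (k + 2%:R) * y (k + 1))).

Definition principal_curvature nu s k : R := s k - nu k * (s (k + 1) * s (k + 2%:R)).

(** Here [dx i j] stands for the derivative of [x j] along the [i]-th frame field, and [ddz i j] for
    the second derivative of [z k]. Antisymmetrized second derivatives of [z k] become first
    derivatives along [cross x y], which the bracket term removes; the remaining derivatives cancel
    as well. *)
Lemma curvature_coefficients nu s x y z (dx dy dz : 'I_3 -> 'I_3 -> R)
    (ddz : 'I_3 -> 'I_3 -> R) k :
  let G := christoffel nu s in
  let N u v dv l := \sum_i u i * dv i l + G u v l in
  let DN u v du dv i :=
    \sum_j (du i j * dv j k + u j * ddz i j) + (G (du i) v k + G u (dv i) k) in
  let b l := \sum_i (x i * dy i l - y i * dx i l) + cross x y l in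
  let kap := principal_curvature nu s in
  (forall i, ddz i (i + 1) - ddz (i + 1) i = dz (i + 2%:R) k) ->
  (\sum_i x i * DN y z dy dz i + G x (N y z dz) k) -
  (\sum_i y i * DN x z dx dz i + G y (N x z dz) k) -
  (\sum_i b i * dz i k + G b z k) =
  nu k * (kap (k + 2%:R) * cross x y (k + 2%:R) * z (k + 1) -
          kap (k + 1) * cross x y (k + 1) * z (k + 2%:R)).
Proof.
move=> G N DN b kap comm_ddz.
have comm i : ddz i (i + 1) = dz (i + 2%:R) k + ddz (i + 1) i.
  by apply/eqP; rewrite -subr_eq comm_ddz.
have := (comm 0, comm 1, comm 2%:R); rewrite !ord3E => comm012.
rewrite /N /DN /b /kap /principal_curvature /G /christoffel /cross !sum3 !comm012.
by elim/ord3_ind: k {comm_ddz comm comm012 N DN b kap G}; rewrite !ord3E; ring.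
Qed.

(** Regrouping: the two terms containing [kap k * cross x y k] have as cofactors the two halves of
    [cross x y k]. *)
Lemma sum_curvature_form (kap x y : 'I_3 -> R) :
  \sum_k (kap (k + 2%:R) * cross x y (k + 2%:R) * y (k + 1) -
          kap (k + 1) * cross x y (k + 1) * y (k + 2%:R)) * x k =
  \sum_k kap k * cross x y k ^+ 2.
Proof. by rewrite /cross !sum3 !ord3E; ring. Qed.

(** The Gram determinant of two vectors for the weights [mu], which is the denominator of the
    sectional curvature. *)
Lemma lagrange_identity (mu x y : 'I_3 -> R) :
  (\sum_k mu k * (x k * x k)) * (\sum_k mu k * (y k * y k)) -
  (\sum_k mu k * (x k * y k)) ^+ 2 =
  \sum_k mu (k + 1) * mu (k + 2%:R) * cross x y k ^+ 2.
Proof. by rewrite /cross !sum3 !ord3E; ring. Qed.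

End CurvatureAlgebra.

(** * Left-invariant frames *)

Section FrameFields.
Context (R : realType).
Implicit Types (p : SO3 R) (f g : SO3 R -> R) (X Y Z : SO3 R -> 'M[R]_3).
Implicit Types (i j k : 'I_3).

(** Orthonormality for [ip0] makes components readable as inner products; the bracket relation fixes
    the orientation. *)
Record so3_frame (e : 'I_3 -> 'M[R]_3) : Prop := So3Frame {
  frame_so3 : forall k, so3 (e k);
  frame_bracket : forall k,
    e k *m e (k + 1) - e (k + 1) *m e k = e (k + 2%:R);
  frame_orthonormal : forall i j, ip0 (e i) (e j) = (i == j)%:R;
  frame_span : forall A, so3 A -> A = \sum_k ip0 A (e k) *: e k }.

Lemma ip0_linear (a : R) (A B C : 'M[R]_3) :
  ip0 (a *: A + B) C = a * ip0 A C + ip0 B C.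
Proof. by rewrite /ip0 mulmxDl -scalemxAl linearD linearZ /= mulrDr mulrCA. Qed.

Lemma ip0_sum (I : finType) (c : I -> R) (A : I -> 'M[R]_3) (C : 'M[R]_3) :
  ip0 (\sum_i c i *: A i) C = \sum_i c i * ip0 (A i) C.
Proof.
rewrite /ip0 mulmx_suml linear_sum mulr_sumr; apply: eq_bigr => i _.
by rewrite -scalemxAl linearZ /= mulrCA.
Qed.

Context (e : 'I_3 -> 'M[R]_3) (he : so3_frame e).

Definition field_of (c : 'I_3 -> SO3 R -> R) : SO3 R -> 'M[R]_3 :=
  fun p => \sum_k c k p *: (val p *m e k).

Definition component p (u : 'M[R]_3) k : R := ip0 ((val p)^T *m u) (e k).

Definition coef X k p : R := component p (X p) k.

Local Notation D i := (left_derive (e i)).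

Lemma tangent_frame p k : tangent p (val p *m e k).
Proof. exact/tangent_left_translate/frame_so3. Qed.

Lemma tangent_field_of c p : tangent p (field_of c p).
Proof. by apply: tangent_sum => k; apply: tangentZ; exact: tangent_frame. Qed.

Lemma coef_field_of c k p : coef (field_of c) k p = c k p.
Proof.
rewrite /coef /component /field_of mulmx_sumr.
under eq_bigr do rewrite -scalemxAr mulmxA SO3_trV mul1mx.
rewrite ip0_sum (bigD1 k)//= big1 ?addr0 => [|i ne].
  by rewrite (frame_orthonormal he) eqxx mulr1.
by rewrite (frame_orthonormal he) (negbTE ne) mulr0.
Qed.

Lemma field_of_coef X p : tangent p (X p) -> field_of (coef X) p = X p.
Proof.
move=> tX; rewrite /field_of; under eq_bigr do rewrite scalemxAr.
by rewrite -mulmx_sumr -(frame_span he tX) mulmxA SO3_Vtr mul1mx.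
Qed.

Lemma component_linear p (a : R) (u v : 'M[R]_3) k :
  component p (a *: u + v) k = a * component p u k + component p v k.
Proof. by rewrite /component mulmxDr -scalemxAr ip0_linear. Qed.

Lemma componentD p (u v : 'M[R]_3) k :
  component p (u + v) k = component p u k + component p v k.
Proof. by rewrite -{1}[u]scale1r component_linear mul1r. Qed.

Lemma componentB p (u v : 'M[R]_3) k :
  component p (u - v) k = component p u k - component p v k.
Proof. by rewrite addrC -scaleN1r component_linear mulN1r addrC. Qed.

Lemma component0 p k : component p 0 k = 0.
Proof. by rewrite -(subrr (0 : 'M[R]_3)) componentB subrr. Qed.

Lemma componentZ p (a : R) (u : 'M[R]_3) k :
  component p (a *: u) k = a * component p u k.
Proof. by rewrite -[a *: u]addr0 component_linear component0 addr0. Qed.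

Lemma tangent_eq p (u v : 'M[R]_3) : tangent p u -> tangent p v ->
  (forall k, component p u k = component p v k) -> u = v.
Proof.
move=> tu tv uv.
rewrite -(@field_of_coef (fun=> u) p tu) -(@field_of_coef (fun=> v) p tv).
by apply: eq_bigr => k _; rewrite /coef uv.
Qed.

Lemma field_of_coef_ext X : vfield X -> field_of (coef X) = X.
Proof. by move=> [_ tX]; apply: funext => p; exact: field_of_coef. Qed.

Lemma vfield_field_of c : (forall k, smoothSO3 (c k)) -> vfield (field_of c).
Proof.
move=> sc; split=> [|p]; last exact: tangent_field_of.
apply: smoothSO3_sum => k; have [C [sC Cc]] := sc k.
exists (fun x => C x *: (x *m e k)); split=> [|p]; last by rewrite Cc.
exact: smooth_scale_translate.
Qed.

Lemma smoothSO3_coef X k : vfield X -> smoothSO3 (coef X k).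
Proof.
move=> [[F [sF FX]] _]; exists (fun x : 'M[R]_3 =>
  2^-1 * \sum_i \sum_j (\sum_l x l i * F x l j) * e k i j).
split=> [|p].
  apply: smoothM; first exact: smooth_cst.
  apply: smooth_sum => i; apply: smooth_sum => j.
  apply: smoothM; last exact: smooth_cst.
  apply: smooth_sum => l; apply: smoothM; apply: smooth_coord => //.
  exact: smooth_id.
rewrite /coef /component ip0E FX; congr (_ * _).
apply: eq_bigr => i _; apply: eq_bigr => j _.
by rewrite mxE; congr (_ * _); apply: eq_bigr => l _; rewrite mxE.
Qed.

Lemma tderive_frame (W : normedModType R) (f : SO3 R -> W) X p :
  smoothSO3 f -> tangent p (X p) ->
  tderive f p (X p) = \sum_i coef X i p *: tderive f p (val p *m e i).
Proof.
move=> [F Ff] tX; have [sF _] := Ff; rewrite (tderiveE Ff tX).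
rewrite -{1}(field_of_coef tX) (deriveE _ (smooth_differentiable _ sF)) linear_sum.
apply: eq_bigr => i _; rewrite linearZ /= (tderiveE Ff (tangent_frame p i)).
by rewrite (deriveE _ (smooth_differentiable _ sF)).
Qed.

Lemma tderive_real f X p : smoothSO3 f -> tangent p (X p) ->
  tderive f p (X p) = \sum_i coef X i p * D i f p.
Proof. exact: tderive_frame. Qed.

Lemma left_derive_add f g k p : smoothSO3 f -> smoothSO3 g ->
  D k (fun q => f q + g q) p = D k f p + D k g p.
Proof. by move=> sf sg; apply: (tderive_add sf sg); exact: tangent_frame. Qed.

Lemma left_derive_mul f g k p : smoothSO3 f -> smoothSO3 g ->
  D k (fun q => f q * g q) p = f p * D k g p + g p * D k f p.
Proof. by move=> sf sg; apply: (tderive_mul sf sg); exact: tangent_frame. Qed.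

Lemma left_derive_cst (c : R) k p : D k (fun=> c) p = 0.
Proof. exact/tderive_cst/tangent_frame. Qed.

Lemma left_deriveZ f (c : R) k p : smoothSO3 f ->
  D k (fun q => c * f q) p = c * D k f p.
Proof.
move=> sf; rewrite (left_derive_mul _ _ (smoothSO3_cst c) sf).
by rewrite left_derive_cst mulr0 addr0.
Qed.

Lemma left_derive_sum (I : finType) (f : I -> SO3 R -> R) k p :
  (forall l : I, smoothSO3 (f l)) ->
  D k (fun q => \sum_l f l q) p = \sum_l D k (f l) p.
Proof. by move=> sf; apply: (tderive_sum sf); exact: tangent_frame. Qed.

Lemma smoothSO3_D f k : smoothSO3 f -> smoothSO3 (D k f).
Proof. exact/smoothSO3_left_derive/frame_so3. Qed.

Lemma left_derive_bracket f k p : smoothSO3 f ->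
  D k (D (k + 1) f) p - D (k + 1) (D k f) p = D (k + 2%:R) f p.
Proof.
move=> sf; rewrite left_derive_commutator ?(frame_bracket he)//; exact: frame_so3.
Qed.

(** The terms [v *m e k] come from differentiating the frame in the ambient space. They need not be
    tangent; only their antisymmetrization in [bracket] is. *)
Lemma tderive_field_of c p v : (forall k, smoothSO3 (c k)) -> tangent p v ->
  tderive (field_of c) p v =
  \sum_k (tderive (c k) p v *: (val p *m e k) + c k p *: (v *m e k)).
Proof.
move=> sc tv; rewrite (tderive_sum _ tv) => [|k]; last first.
  have [C [sC Cc]] := sc k; exists (fun x => C x *: (x *m e k)).
  by split=> [|q]; [exact: smooth_scale_translate|rewrite Cc].
apply: eq_bigr => k _; have [C Cc] := sc k; have [sC CC] := Cc.
rewrite (tderiveE Cc tv) (@tderiveE _ _ _ (fun x => C x *: (x *m e k)))//.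
  by rewrite derive_scale_translate// CC.
by split=> [|q]; [exact: smooth_scale_translate|rewrite CC].
Qed.

Lemma frame_commutator (x y : 'I_3 -> R) :
  (\sum_i x i *: e i) *m (\sum_j y j *: e j) -
  (\sum_i y i *: e i) *m (\sum_j x j *: e j) =
  \sum_k cross x y k *: e k.
Proof.
transitivity (\sum_k cross x y k *:
    (e (k + 1) *m e (k + 2%:R) - e (k + 2%:R) *m e (k + 1))); last first.
  apply: eq_bigr => k _; congr (_ *: _); have := frame_bracket he (k + 1).
  by elim/ord3_ind: k; rewrite !ord3E.
rewrite !sum3 /cross !ord3E !mulmxDl !mulmxDr -!scalemxAl -!scalemxAr.
move: (e 0 *m e 0) (e 0 *m e 1) (e 0 *m e 2%:R) (e 1 *m e 0) (e 1 *m e 1)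
  (e 1 *m e 2%:R) (e 2%:R *m e 0) (e 2%:R *m e 1) (e 2%:R *m e 2%:R).
move=> e00 e01 e02 e10 e11 e12 e20 e21 e22.
by apply/matrixP => i j; rewrite !mxE; ring.
Qed.

End FrameFields.

(** * The Levi-Civita connection *)

Section LeviCivitaConnection.
Context (R : realType) (e : 'I_3 -> 'M[R]_3) (he : so3_frame e).
Context (mu : 'I_3 -> R) (mu_gt0 : forall k, 0 < mu k).
Context (m : metric_field R) (riem : riemannian_metric m).
Context (m_frame : forall p i j,
  m p (val p *m e i) (val p *m e j) = mu i * (i == j)%:R).
Implicit Types (p : SO3 R) (f g : SO3 R -> R) (X Y Z : SO3 R -> 'M[R]_3).
Implicit Types (i j k : 'I_3).

Local Notation D i := (left_derive (e i)).
Local Notation coef := (coef e).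
Local Notation component := (component e).

Lemma metric_linear_l p (a : R) (u v w : 'M[R]_3) :
  tangent p u -> tangent p v -> tangent p w ->
  m p (a *: u + v) w = a * m p u w + m p v w.
Proof. by case: riem => lin _ _ _; exact: lin. Qed.

Lemma metric_sym p (u v : 'M[R]_3) : tangent p u -> tangent p v -> m p u v = m p v u.
Proof. by case: riem => _ sym _ _; exact: sym. Qed.

Lemma tangent0 p : tangent p (0 : 'M[R]_3).
Proof. by rewrite /tangent /so3 mulmx0 linear0 oppr0. Qed.

Lemma metricBl p (u v w : 'M[R]_3) : tangent p u -> tangent p v -> tangent p w ->
  m p (u - v) w = m p u w - m p v w.
Proof.
move=> tu tv tw; rewrite addrC -scaleN1r (metric_linear_l _ tv tu tw).
by rewrite mulN1r addrC.
Qed.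

Lemma metric0l p (w : 'M[R]_3) : tangent p w -> m p 0 w = 0.
Proof.
move=> tw; have := metric_linear_l 1 (tangent0 p) (tangent0 p) tw.
by rewrite scaler0 addr0 mul1r => /eqP; rewrite -subr_eq0 opprD addNKr oppr_eq0 => /eqP.
Qed.

Lemma metric_sum_l p (c : 'I_3 -> R) (u : 'I_3 -> 'M[R]_3) (w : 'M[R]_3) :
  (forall k, tangent p (u k)) -> tangent p w ->
  m p (\sum_k c k *: u k) w = \sum_k c k * m p (u k) w.
Proof.
(* Tangency of the partial sums is carried along because [m] is linear on tangent vectors only. *)
move=> tu tw; pose P (x : 'M[R]_3) (a : R) := tangent p x /\ m p x w = a.
suff [] : P (\sum_k c k *: u k) (\sum_k c k * m p (u k) w) by [].
apply: (big_rec2 P) => [|k x a _ [tx <-]].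
  by split; [exact: tangent0|exact: metric0l].
by split; [exact: tangentD|rewrite metric_linear_l].
Qed.

Lemma metric_component p (u v : 'M[R]_3) : tangent p u -> tangent p v ->
  m p u v = \sum_k mu k * (component p u k * component p v k).
Proof.
move=> tu tv; have tf k := tangent_frame he p k.
rewrite -{1}(@field_of_coef _ _ he (fun=> u) p tu) metric_sum_l//.
apply: eq_bigr => k _; rewrite metric_sym//.
rewrite -{1}(@field_of_coef _ _ he (fun=> v) p tv) metric_sum_l//.
rewrite (bigD1 k)//= big1 => [|i ne]; last by rewrite m_frame (negbTE ne) !mulr0.
by rewrite m_frame eqxx addr0 mulr1 mulrA mulrC.
Qed.

Definition bracket_coef X Y k p : R :=
  \sum_i (coef X i p * D i (coef Y k) p - coef Y i p * D i (coef X k) p) +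
  cross (coef X ^~ p) (coef Y ^~ p) k.

(** The first sum differentiates the components of [Y], the matrix product differentiates the frame;
    in [bracket] the products form a commutator, hence a cross product. *)
Lemma tderive_component X Y p : vfield X -> vfield Y ->
  tderive Y p (X p) =
  \sum_k (\sum_i coef X i p * D i (coef Y k) p) *: (val p *m e k) +
  val p *m ((\sum_i coef X i p *: e i) *m (\sum_k coef Y k p *: e k)).
Proof.
move=> vX vY; have tX := vX.2 p.
rewrite -{1}(field_of_coef_ext he vY).
rewrite (tderive_field_of e (fun k => smoothSO3_coef e k vY) tX) big_split /=.
congr (_ + _).
  apply: eq_bigr => k _; rewrite (tderive_real he _ tX)//.
  exact: smoothSO3_coef.
rewrite mulmxA mulmx_sumr; apply: eq_bigr => k _.
rewrite -scalemxAr; congr (_ *: (_ *m _)).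
rewrite mulmx_sumr -{1}(field_of_coef he tX); apply: eq_bigr => i _.
exact: scalemxAr.
Qed.

Lemma bracketE X Y p : vfield X -> vfield Y ->
  bracket X Y p = field_of e (bracket_coef X Y) p.
Proof.
move=> vX vY; rewrite /bracket !tderive_component// opprD addrACA -mulmxBr.
rewrite (frame_commutator he) mulmx_sumr -sumrB -big_split; apply: eq_bigr => k _ /=.
by rewrite -scalerBl -scalemxAr -scalerDl -sumrB.
Qed.


Let nu k : R := (mu k)^-1.
Let s k : R := (mu (k + 1) + mu (k + 2%:R) - mu k) / 2.

(* The [k]-th component of nabla_X Y at a point, where [x] and [y] are the
   components of X and Y and [dyk] the frame derivatives of [y k]. *)
Definition covariant_component (x dyk y : 'I_3 -> R) k : R :=
  \sum_i x i * dyk i + christoffel nu s x y k.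

Definition lc_coef X Y k p : R :=
  covariant_component (coef X ^~ p) (fun i => D i (coef Y k) p) (coef Y ^~ p) k.

Definition lc_connection : connection R := fun X Y => field_of e (lc_coef X Y).

Local Notation sm := (smoothSO3_coef e).

Lemma smoothSO3_mulZ f g (a : R) : smoothSO3 f -> smoothSO3 g ->
  smoothSO3 (fun q => a * (f q * g q)).
Proof.
by move=> sf sg; exact: smoothSO3_mul (smoothSO3_cst a) (smoothSO3_mul sf sg).
Qed.

Lemma smooth_christoffel X Y k : vfield X -> vfield Y ->
  smoothSO3 (fun q => christoffel nu s (coef X ^~ q) (coef Y ^~ q) k).
Proof.
move=> vX vY; apply: smoothSO3_mul; first exact: smoothSO3_cst.
by apply: smoothSO3_add; apply: smoothSO3_mulZ; exact: sm.
Qed.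

Lemma smooth_lc_coef X Y k : vfield X -> vfield Y -> smoothSO3 (lc_coef X Y k).
Proof.
move=> vX vY; apply: smoothSO3_add; last exact: smooth_christoffel.
apply: smoothSO3_sum => i; apply: smoothSO3_mul; first exact: sm.
by apply: (smoothSO3_D he); exact: sm.
Qed.

(** Product rule, [christoffel] being bilinear; the right-hand side is [DN] of
    [curvature_coefficients]. *)
Lemma left_derive_lc_coef X Y i k p : vfield X -> vfield Y ->
  D i (lc_coef X Y k) p =
  \sum_j (D i (coef X j) p * D j (coef Y k) p +
          coef X j p * D i (D j (coef Y k)) p) +
  (christoffel nu s (fun j => D i (coef X j) p) (coef Y ^~ p) k +
   christoffel nu s (coef X ^~ p) (fun j => D i (coef Y j) p) k).
Proof.
move=> vX vY; have sX j := sm j vX; have sY j := sm j vY.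
have sDY j := smoothSO3_D he j (sY k).
have sXDY j := smoothSO3_mul (sX j) (sDY j).
rewrite (left_derive_add he _ _ (smoothSO3_sum sXDY) (smooth_christoffel k vX vY)).
rewrite (left_derive_sum he _ _ sXDY); congr (_ + _).
  apply: eq_bigr => j _; rewrite (left_derive_mul he _ _ (sX j) (sDY j)).
  have swap (a b c d : R) : a * d + b * c = c * b + a * d by ring.
  exact: swap.
pose a := fun q => s (k + 1) * (coef X (k + 1) q * coef Y (k + 2%:R) q).
pose b := fun q => - s (k + 2%:R) * (coef X (k + 2%:R) q * coef Y (k + 1) q).
have sa : smoothSO3 a by exact: smoothSO3_mulZ.
have sb : smoothSO3 b by exact: smoothSO3_mulZ.
rewrite (left_deriveZ he _ _ _ (smoothSO3_add sa sb)) (left_derive_add he _ _ sa sb).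
pose g1 q := coef X (k + 1) q * coef Y (k + 2%:R) q.
pose g2 q := coef X (k + 2%:R) q * coef Y (k + 1) q.
have sg1 : smoothSO3 g1 by exact: smoothSO3_mul.
have sg2 : smoothSO3 g2 by exact: smoothSO3_mul.
have -> : D i a p = s (k + 1) * D i g1 p by exact: left_deriveZ.
have -> : D i b p = - s (k + 2%:R) * D i g2 p by exact: left_deriveZ.
rewrite (left_derive_mul he i p (sX (k + 1)) (sY (k + 2%:R)) : D i g1 p = _).
rewrite (left_derive_mul he i p (sX (k + 2%:R)) (sY (k + 1)) : D i g2 p = _).
rewrite /christoffel.
move: (coef X (k + 1) p) (coef X (k + 2%:R) p) => x1 x2.
move: (coef Y (k + 1) p) (coef Y (k + 2%:R) p) => y1 y2.
move: (D i (coef X (k + 1)) p) (D i (coef X (k + 2%:R)) p) => dx1 dx2.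
move: (D i (coef Y (k + 1)) p) (D i (coef Y (k + 2%:R)) p) => dy1 dy2.
by ring.
Qed.

Lemma coef_lc X Y k : coef (lc_connection X Y) k = lc_coef X Y k.
Proof. by apply: funext => p; exact: coef_field_of. Qed.

Lemma component_lc X Y k p : component p (lc_connection X Y p) k = lc_coef X Y k p.
Proof. exact: coef_field_of. Qed.

Lemma vfield_lc X Y : vfield X -> vfield Y -> vfield (lc_connection X Y).
Proof. by move=> vX vY; apply: (vfield_field_of he) => k; exact: smooth_lc_coef. Qed.

Lemma tangent_lc X Y p : tangent p (lc_connection X Y p).
Proof. exact: tangent_field_of. Qed.

Lemma component_bracket X Y k p : vfield X -> vfield Y ->
  component p (bracket X Y p) k = bracket_coef X Y k p.
Proof. by move=> vX vY; rewrite bracketE//; exact: coef_field_of. Qed.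

Lemma tangent_bracket X Y p : vfield X -> vfield Y -> tangent p (bracket X Y p).
Proof. by move=> vX vY; rewrite bracketE//; exact: tangent_field_of. Qed.

Lemma vfield_bracket X Y : vfield X -> vfield Y -> vfield (bracket X Y).
Proof.
move=> vX vY; rewrite (_ : bracket X Y = field_of e (bracket_coef X Y)); last first.
  by apply: funext => p; exact: bracketE.
have sX k := sm k vX; have sY k := sm k vY.
apply: (vfield_field_of he) => k; apply: smoothSO3_add.
  apply: smoothSO3_sum => i; apply: smoothSO3_sub; apply: smoothSO3_mul => //;
  exact: (smoothSO3_D he).
by apply: smoothSO3_sub; exact: smoothSO3_mul.
Qed.

Lemma vfield_sub X Y : vfield X -> vfield Y -> vfield (fun q => X q - Y q).
Proof.
move=> vX vY.
rewrite (_ : (fun q => _) = field_of e (fun k q => coef X k q - coef Y k q)).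
  by apply: (vfield_field_of he) => k; apply: smoothSO3_sub; exact: sm.
apply: funext => p; have tX := vX.2 p; have tY := vY.2 p.
rewrite -{1}(field_of_coef he tX) -{1}(field_of_coef he tY) -sumrB.
by apply: eq_bigr => k _; rewrite -scalerBl.
Qed.

(** This and the next two identities are the connection axioms at one point, with the derivatives as
    free variables. *)
Lemma covariant_component_linear_l (a : R) (x x' dyk y : 'I_3 -> R) k :
  covariant_component (fun j => a * x j + x' j) dyk y k =
  a * covariant_component x dyk y k + covariant_component x' dyk y k.
Proof. by rewrite /covariant_component /christoffel !sum3; ring. Qed.

Lemma covariant_component_add_r (x dyk dyk' y y' : 'I_3 -> R) k :
  covariant_component x (fun i => dyk i + dyk' i) (fun j => y j + y' j) k =
  covariant_component x dyk y k + covariant_component x dyk' y' k.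
Proof. by rewrite /covariant_component /christoffel !sum3; ring. Qed.

Lemma covariant_component_leibniz (a : R) (x da dyk y : 'I_3 -> R) k :
  covariant_component x (fun i => a * dyk i + y k * da i) (fun j => a * y j) k =
  (\sum_i x i * da i) * y k + a * covariant_component x dyk y k.
Proof. by rewrite /covariant_component /christoffel !sum3; ring. Qed.

Lemma lc_linear_l f X X' Y p :
  lc_connection (fun q => f q *: X q + X' q) Y p =
  f p *: lc_connection X Y p + lc_connection X' Y p.
Proof.
apply: (tangent_eq he) => [||k]; first exact: tangent_lc.
  by apply: tangentD; exact: tangent_lc.
rewrite component_linear !component_lc -covariant_component_linear_l.
rewrite /lc_coef; congr covariant_component; apply: funext => j.
exact: component_linear.
Qed.

Lemma tangentB p (u v : 'M[R]_3) : tangent p u -> tangent p v -> tangent p (u - v).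
Proof. by move=> tu tv; rewrite addrC -scaleN1r; exact: tangentD. Qed.

Lemma lc_add_r X Y Y' p : vfield Y -> vfield Y' ->
  lc_connection X (fun q => Y q + Y' q) p = lc_connection X Y p + lc_connection X Y' p.
Proof.
move=> vY vY'.
apply: (tangent_eq he) => [||k]; first exact: tangent_lc.
  by rewrite -[lc_connection X Y p]scale1r; apply: tangentD; exact: tangent_lc.
rewrite componentD !component_lc -covariant_component_add_r.
have cE j : coef (fun q => Y q + Y' q) j = fun q => coef Y j q + coef Y' j q.
  by apply: funext => q; exact: componentD.
rewrite /lc_coef; congr covariant_component; apply: funext => j; rewrite cE//.
by apply: left_derive_add => //; exact: sm.
Qed.

Lemma lc_leibniz f X Y p : smoothSO3 f -> vfield X -> vfield Y ->
  lc_connection X (fun q => f q *: Y q) p =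
  tderive f p (X p) *: Y p + f p *: lc_connection X Y p.
Proof.
move=> sf vX vY; have tY := vY.2 p.
apply: (tangent_eq he) => [||k]; first exact: tangent_lc.
  by apply: tangentD => //; apply: tangentZ; exact: tangent_lc.
rewrite componentD !componentZ !component_lc (tderive_real he sf (vX.2 p)).
rewrite -covariant_component_leibniz.
have cE j : coef (fun q => f q *: Y q) j = fun q => f q * coef Y j q.
  by apply: funext => q; exact: componentZ.
rewrite /lc_coef; congr covariant_component; apply: funext => j; rewrite cE//.
by apply: left_derive_mul => //; exact: sm.
Qed.

Lemma nu_mu k : nu k * mu k = 1.
Proof. by rewrite mulVf// gt_eqF. Qed.

(** Vanishing torsion amounts to [s (k + 1) + s (k + 2%:R) = mu k]. *)
Lemma covariant_component_torsion (x y : 'I_3 -> R) (dx dy : 'I_3 -> 'I_3 -> R) k :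
  covariant_component x (dy ^~ k) y k - covariant_component y (dx ^~ k) x k =
  \sum_i (x i * dy i k - y i * dx i k) + cross x y k.
Proof.
have torsion : christoffel nu s x y k - christoffel nu s y x k = cross x y k.
  transitivity (nu k * mu k * cross x y k); last by rewrite nu_mu mul1r.
  rewrite /christoffel /cross /s.
  by elim/ord3_ind: k; rewrite !ord3E; field.
by rewrite -torsion /covariant_component opprD addrACA -sumrB.
Qed.

(** Once [mu] has cancelled [nu], the derivative-free terms of the first sum add up to the sum of
    [s i * x i * cross y z i], which is skew in [y] and [z], so the second sum cancels them. *)
Lemma covariant_component_metric (x y z : 'I_3 -> R) (dy dz : 'I_3 -> 'I_3 -> R) :
  \sum_i x i * (\sum_k mu k * (y k * dz i k + z k * dy i k)) =
  \sum_k mu k * (covariant_component x (dy ^~ k) y k * z k) +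
  \sum_k mu k * (y k * covariant_component x (dz ^~ k) z k).
Proof.
have mu_component (u dvk v : 'I_3 -> R) k (c : R) :
    mu k * (covariant_component u dvk v k * c) =
    (mu k * (\sum_i u i * dvk i) +
     (s (k + 1) * (u (k + 1) * v (k + 2%:R)) +
      - s (k + 2%:R) * (u (k + 2%:R) * v (k + 1)))) * c.
  rewrite mulrA; congr (_ * _); rewrite mulrDr; congr (_ + _).
  have cancel (E : R) : mu k * (nu k * E) = E by rewrite mulrCA mulrA nu_mu mul1r.
  exact: cancel.
under [X in _ = X + _]eq_bigr do rewrite mu_component.
under [X in _ = _ + X]eq_bigr do rewrite [y _ * _]mulrC mu_component.
rewrite !sum3 !ord3E; ring.
Qed.

Lemma lc_metric_compatible : metric_compatible m lc_connection.
Proof.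
move=> X Y Z vX vY vZ p; have sY k := sm k vY; have sZ k := sm k vZ.
pose yz k q := mu k * (coef Y k q * coef Z k q).
have syz k : smoothSO3 (yz k) by exact: smoothSO3_mulZ.
have -> : (fun q => m q (Y q) (Z q)) = fun q => \sum_k yz k q.
  by apply: funext => q; rewrite metric_component; [|exact: vY.2|exact: vZ.2].
rewrite (tderive_real he (smoothSO3_sum syz) (vX.2 p)).
rewrite (metric_component (tangent_lc X Y p) (vZ.2 p)).
rewrite (metric_component (vY.2 p) (tangent_lc X Z p)).
under [X in _ = X + _]eq_bigr do rewrite component_lc.
under [X in _ = _ + X]eq_bigr do rewrite component_lc.
apply: etrans (covariant_component_metric (coef X ^~ p) (coef Y ^~ p)
  (coef Z ^~ p) (fun i k => D i (coef Y k) p) (fun i k => D i (coef Z k) p)).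
apply: eq_bigr => i _; congr (_ * _).
rewrite (left_derive_sum he _ _ syz); apply: eq_bigr => k _.
have dYZ := left_derive_mul he i p (sY k) (sZ k).
by rewrite (left_deriveZ he _ _ _ (smoothSO3_mul (sY k) (sZ k))) dYZ.
Qed.

Lemma lc_torsion_free : torsion_free lc_connection.
Proof.
move=> X Y vX vY p; apply: (tangent_eq he) => [||k].
- by apply: tangentB; exact: tangent_lc.
- exact: tangent_bracket.
rewrite componentB !component_lc component_bracket//.
exact: (covariant_component_torsion _ _ (fun i k => D i (coef X k) p)
  (fun i k => D i (coef Y k) p)).
Qed.

Lemma lc_levi_civita : levi_civita m lc_connection.
Proof.
split; [split| |].
- exact: vfield_lc.
- by move=> f X X' Y _ _ _ _ p; exact: lc_linear_l.
- by move=> X Y Y' _ vY vY' p; exact: lc_add_r.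
- by move=> f X Y sf vX vY p; exact: lc_leibniz.
- exact: lc_torsion_free.
- exact: lc_metric_compatible.
Qed.

(* The difference of two Levi-Civita connections is symmetric in its first two
   arguments and skew in its last two, hence zero. *)
Lemma levi_civita_unique nabla X Y : levi_civita m nabla ->
  vfield X -> vfield Y -> nabla X Y = lc_connection X Y.
Proof.
move=> [[vnabla _ _ _] torsion compat] vX vY.
have [[vlc _ _ _] lc_torsion lc_compat] := lc_levi_civita.
pose delta (U V W : SO3 R -> 'M[R]_3) p :=
  m p (nabla U V p) (W p) - m p (lc_connection U V p) (W p).
have skew U V W p : vfield U -> vfield V -> vfield W ->
    delta U V W p = - delta U W V p.
  move=> vU vV vW; have := compat U V W vU vV vW p.
  rewrite (lc_compat U V W vU vV vW p) /delta.
  rewrite [m p (V p) _]metric_sym; [|exact: vV.2|exact: tangent_lc].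
  rewrite [m p (V p) (nabla _ _ _)]metric_sym; [|exact: vV.2|exact: (vnabla _ _ vU vW).2].
  move: (m p _ _) (m p _ _) (m p _ _) (m p _ _) => a b c d; lra.
have diff U V W p : vfield U -> vfield V -> vfield W ->
    delta U V W p = m p (nabla U V p - lc_connection U V p) (W p).
  move=> vU vV vW.
  exact: (esym (metricBl ((vnabla _ _ vU vV).2 p) (tangent_lc U V p) (vW.2 p))).
have sym U V W p : vfield U -> vfield V -> vfield W ->
    delta U V W p = delta V U W p.
  have swap (a b c d : 'M[R]_3) : a - b = c - d -> a - c = b - d.
    move=> /eqP; rewrite subr_eq => /eqP ->.
    by rewrite -addrA [b - c]addrC addrACA subrr add0r addrC.
  move=> vU vV vW; rewrite (diff U V) ?(diff V U)//; congr (m p _ _).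
  by apply: swap; rewrite torsion// lc_torsion.
apply: funext => p.
(* Testing the difference against itself: positive definiteness turns [delta X Y W p = 0] into
   [W p = 0]. *)
pose W q := nabla X Y q - lc_connection X Y q.
have vW : vfield W by apply: vfield_sub; [exact: vnabla|exact: vlc].
have W0 : delta X Y W p = 0.
  (* Alternating the two exchanges, three times each, returns to the original order with sign
     (-1)^3. *)
  have : delta X Y W p = - delta X Y W p.
    rewrite {1}skew// sym// skew// opprK sym// skew// sym//.
  by move=> eqN; lra.
apply/eqP; rewrite -subr_eq0; apply: contraT => Wn0.
have [_ _ pos _] := riem.
by have := pos p (W p) (vW.2 p) Wn0; rewrite -diff// W0 ltxx.
Qed.

(** * Curvature in the frame and the sign criterion *)

Lemma component_curvature X Y Z k p : vfield X -> vfield Y -> vfield Z ->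
  component p (curvature lc_connection X Y Z p) k =
  let w := cross (coef X ^~ p) (coef Y ^~ p) in
  let kap := principal_curvature nu s in
  nu k * (kap (k + 2%:R) * w (k + 2%:R) * coef Z (k + 1) p -
          kap (k + 1) * w (k + 1) * coef Z (k + 2%:R) p).
Proof.
move=> vX vY vZ.
rewrite /curvature !componentB !component_lc /lc_coef !coef_lc.
apply: etrans (curvature_coefficients _ _ _ _ _
  (fun i j => D i (coef X j) p) (fun i j => D i (coef Y j) p)
  (dz := fun i j => D i (coef Z j) p)
  (ddz := fun i j => D i (D j (coef Z k)) p) _); last first.
  by move=> i; apply: (left_derive_bracket he); exact: sm.
rewrite /covariant_component.
congr (_ + _ - (_ + _) - (_ + _)).
- by apply: eq_bigr => i _; rewrite left_derive_lc_coef.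
- by congr christoffel; apply: funext => l; rewrite coef_lc.
- by apply: eq_bigr => i _; rewrite left_derive_lc_coef.
- by congr christoffel; apply: funext => l; rewrite coef_lc.
- by apply: eq_bigr => i _; congr (_ * _); exact: component_bracket.
- by congr christoffel; apply: funext => l; exact: component_bracket.
Qed.

Lemma sectional_curvature_lc X Y p : vfield X -> vfield Y ->
  let w := cross (coef X ^~ p) (coef Y ^~ p) in
  sectional_curvature m lc_connection X Y p =
  (\sum_k principal_curvature nu s k * w k ^+ 2) /
  (\sum_k mu (k + 1) * mu (k + 2%:R) * w k ^+ 2).
Proof.
have cancel k (a b : R) : mu k * (nu k * a * b) = a * b.
  by rewrite -mulrA mulrA [mu k * nu k]mulrC nu_mu mul1r.
move=> vX vY w; have tX := vX.2 p; have tY := vY.2 p.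
rewrite /sectional_curvature !metric_component//; last first.
  by apply: tangentB; [apply: tangentB|]; exact: tangent_lc.
under eq_bigr do rewrite component_curvature// cancel.
congr (_ / _).
  exact: (sum_curvature_form _ (coef X ^~ p) (coef Y ^~ p)).
exact: (lagrange_identity _ (coef X ^~ p) (coef Y ^~ p)).
Qed.

Lemma principal_curvatureE k :
  4 * mu k * principal_curvature nu s k =
  2 * mu (k + 1) * mu k + 2 * mu (k + 2%:R) * mu k - 3 * mu k ^+ 2 +
  (mu (k + 1) - mu (k + 2%:R)) ^+ 2.
Proof.
have cancel (E : R) : mu k * (nu k * E) = E.
  by rewrite mulrA [mu k * _]mulrC nu_mu mul1r.
rewrite /principal_curvature mulrBr -[4 * mu k * (nu k * _)]mulrA cancel.
by rewrite /s; elim/ord3_ind: k {cancel}; rewrite !ord3E; field.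
Qed.

Lemma principal_curvature_ge0 k :
  (0 <= principal_curvature nu s k) =
  (0 <= 2 * mu (k + 1) * mu k + 2 * mu (k + 2%:R) * mu k - 3 * mu k ^+ 2 +
        (mu (k + 1) - mu (k + 2%:R)) ^+ 2).
Proof. by rewrite -principal_curvatureE pmulr_rge0// mulr_gt0. Qed.

Lemma cross_basis k l :
  cross (fun j => (j == k + 1)%:R) (fun j => (j == k + 2%:R)%:R) l = (l == k)%:R :> R.
Proof.
by rewrite /cross; elim/ord3_ind: k; elim/ord3_ind: l;
  rewrite !ord3E /= ?(mulr0, mul0r, mulr1, subr0, subrr).
Qed.

(** The curvature nests [nabla], so uniqueness is used as an equality of fields, which rewrites
    under the outer derivative too. *)
Lemma curvature_unique nabla X Y Z p : levi_civita m nabla ->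
  vfield X -> vfield Y -> vfield Z ->
  curvature nabla X Y Z p = curvature lc_connection X Y Z p.
Proof.
move=> lcn vX vY vZ; have unique U V := @levi_civita_unique nabla U V lcn.
have vXZ := vfield_lc vX vZ; have vYZ := vfield_lc vY vZ.
have vXY := vfield_bracket vX vY.
by rewrite /curvature (unique Y Z)// (unique X Z)// !unique.
Qed.

Lemma nonneg_sectional_curvature_frame :
  nonneg_sectional_curvature m <->
  forall k, 0 <= principal_curvature nu s k.
Proof.
split=> [[nabla lcn nonneg] k|kap_ge0]; last first.
  exists lc_connection => [|X Y p vX vY _]; first exact: lc_levi_civita.
  rewrite sectional_curvature_lc// divr_ge0//; apply: sumr_ge0 => k _.
    by rewrite mulr_ge0// sqr_ge0.
  by rewrite mulr_ge0 ?sqr_ge0// mulr_ge0// ltW.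
(* The frame fields themselves; by [cross_basis] the plane of [E (k + 1)] and [E (k + 2%:R)]
   isolates the [k]-th principal curvature. *)
pose E i := field_of e (fun j _ => (j == i)%:R).
have vE i : vfield (E i) by apply: (vfield_field_of he) => j; exact: smoothSO3_cst.
have coefE i j p : component p (E i p) j = (j == i)%:R by exact: coef_field_of.
pose p := SO3_one R.
have freeE : free [:: E (k + 1) p; E (k + 2%:R) p].
  have neq : (k + 1 == k + 2%:R) = false by elim/ord3_ind: k.
  rewrite free_cons span_seq1 seq1_free; apply/andP; split.
    apply/vlineP => -[c] /(congr1 (fun u => component p u (k + 1))).
    by rewrite componentZ !coefE eqxx neq mulr0 => /eqP; rewrite oner_eq0.
  apply/eqP => /(congr1 (fun u => component p u (k + 2%:R))).
  by rewrite coefE component0 eqxx => /eqP; rewrite oner_eq0.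
have := nonneg _ _ p (vE _) (vE _) freeE.
rewrite /sectional_curvature curvature_unique//.
rewrite -/(sectional_curvature m lc_connection _ _ p) sectional_curvature_lc//.
have wE l : cross (coef (E (k + 1)) ^~ p) (coef (E (k + 2%:R)) ^~ p) l = (l == k)%:R.
  rewrite -cross_basis /cross; congr (_ * _ - _ * _); exact: coef_field_of.
rewrite (bigD1 k)//= big1 => [|l /negbTE nlk]; last by rewrite wE nlk expr0n mulr0.
rewrite [X in _ / X](bigD1 k)//= big1 => [|l /negbTE nlk]; last first.
  by rewrite wE nlk expr0n mulr0.
rewrite wE eqxx expr1n !mulr1 !addr0 pmulr_lge0// invr_gt0.
by rewrite mulr_gt0.
Qed.

Lemma nonneg_sectional_curvatureP :
  nonneg_sectional_curvature m <->
  forall k, 0 <= 2 * mu (k + 1) * mu k + 2 * mu (k + 2%:R) * mu k - 3 * mu k ^+ 2 +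
                 (mu (k + 1) - mu (k + 2%:R)) ^+ 2.
Proof.
by rewrite nonneg_sectional_curvature_frame; split=> kap_ge0 k;
  have := kap_ge0 k; rewrite principal_curvature_ge0.
Qed.

End LeviCivitaConnection.

(** * Diagonalization of symmetric matrices *)

Section SymmetricDiagonalization.
Context (R : rcfType).

Lemma row_norm_eq0 n (v : 'rV[R]_n) : ((v *m v^T) 0 0 == 0) = (v == 0).
Proof.
rewrite mxE psumr_eq0 => [|i _]; last by rewrite mxE -expr2 sqr_ge0.
apply/allP/eqP => [v0|-> i _]; last by rewrite /= !mxE mulr0 eqxx.
apply/rowP => i; have := v0 i (mem_index_enum i).
by rewrite !mxE /= mulf_eq0 orbb => /eqP.
Qed.

(* The reflection exchanging [u] with the first basis vector; if these are equal
   then [2 / t = 2 / 0 = 0] below and the reflection becomes the identity. *)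
Lemma householder n (u : 'rV[R]_n.+1) : u *m u^T = 1%:M ->
  exists2 H : 'M[R]_n.+1, H *m H^T = 1%:M & delta_mx 0 0 *m H = u.
Proof.
move=> uu; pose e : 'rV[R]_n.+1 := delta_mx 0 0; pose w := e - u.
have ee : e *m e^T = 1%:M.
  by rewrite trmx_delta mul_delta_mx; apply/matrixP => i j; rewrite !mxE !ord1.
have eu : e *m u^T = (u 0 0)%:M.
  by rewrite -rowE; apply/matrixP => i j; rewrite !mxE !ord1.
have ue : u *m e^T = (u 0 0)%:M by rewrite -[LHS]trmxK trmx_mul trmxK eu tr_scalar_mx.
(* The squared norm of [w], as [ww] confirms. *)
pose t : R := 2 * (1 - u 0 0).
have ew : e *m w^T = (t / 2)%:M.
  rewrite linearB /= mulmxBr ee eu -raddfB /=; congr (_%:M).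
  by rewrite /t mulrAC divff ?mul1r// pnatr_eq0.
have ww : w *m w^T = t%:M.
  rewrite mulmxBl ew linearB /= mulmxBr ue uu -!raddfB /=; congr (_%:M).
  by rewrite /t; field.
have w0 : t = 0 -> w = 0.
  by move=> t0; apply/eqP; rewrite -row_norm_eq0 ww t0 mxE mul0rn.
pose c := 2 / t; pose H := 1%:M - c *: (w^T *m w).
have HT : H^T = H by rewrite linearB /= trmx1 linearZ /= trmx_mul trmxK.
have e1 : e *m H = u.
  rewrite mulmxBr mulmx1 -scalemxAr mulmxA ew mul_scalar_mx scalerA.
  have [t0|t0] := eqVneq t 0.
    by rewrite (w0 t0) scaler0 subr0; apply/eqP; rewrite -subr_eq0 -/w w0.
  rewrite (_ : c * _ = 1); first by rewrite scale1r opprB addrC subrK.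
  by rewrite /c; field.
exists H => //; rewrite HT mulmxBl mul1mx mulmxBr mulmx1 -scalemxAl -scalemxAr.
rewrite mulmxA -[w^T *m w *m w^T]mulmxA ww mul_mx_scalar -scalemxAl !scalerA.
rewrite -scalerBl (_ : c - c * (c * t) = - c) ?scaleNr ?opprK ?subrK//.
have [t0|t0] := eqVneq t 0; last by rewrite /c; field.
by rewrite /c t0 invr0 !(mulr0, mul0r) oppr0 addr0.
Qed.

Lemma char_poly_similar n (A H : 'M[R]_n) : H *m H^T = 1%:M ->
  char_poly (H *m A *m H^T) = char_poly A.
Proof.
move=> HH; pose P := map_mx (@polyC R) H.
have PP : P *m P^T = 1%:M by rewrite map_trmx -map_mxM HH map_mx1.
rewrite /char_poly (_ : char_poly_mx _ = P *m char_poly_mx A *m P^T).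
  by rewrite !det_mulmx mulrAC -det_mulmx PP det1 mul1r.
rewrite /char_poly_mx mulmxBr mulmxBl !map_mxM -map_trmx; congr (_ - _).
by rewrite mul_mx_scalar -scalemxAl PP scalemx1.
Qed.

(** A unit eigenvector for the first root is moved to the first basis vector by a reflection;
    symmetry then makes the conjugate of [A] block diagonal, and the smaller block inherits the
    remaining roots. The diagonal thus keeps the order of [r]. *)
Lemma orthogonal_diagonalization n (A : 'M[R]_n) (r : seq R) :
  A^T = A -> char_poly A = \prod_(a <- r) ('X - a%:P) ->
  exists2 Q : 'M[R]_n, Q *m Q^T = 1%:M &
    Q *m A = diag_mx (\row_i r`_i) *m Q.
Proof.
elim: n A r => [|n IHn] A r symA chiA.
  by exists 1%:M; [rewrite trmx1 mulmx1|apply/matrixP => -[]].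
case: r chiA => [|a r] chiA.
  have := size_char_poly A; rewrite chiA big_nil size_poly1 => /eqP.
  by rewrite eqSS.
have : eigenvalue A a.
  by rewrite eigenvalue_root_char chiA big_cons rootM root_XsubC eqxx.
move=> /eigenvalueP[v vA v0]; pose q := Num.sqrt ((v *m v^T) 0 0).
have vv0 : 0 < (v *m v^T) 0 0.
  rewrite lt_def row_norm_eq0 v0 mxE sumr_ge0// => i _.
  by rewrite mxE -expr2 sqr_ge0.
have qq : q * q = (v *m v^T) 0 0 by rewrite -expr2 sqr_sqrtr// ltW.
have q0 : q != 0 by rewrite gt_eqF// sqrtr_gt0.
pose u := q^-1 *: v.
have uu : u *m u^T = 1%:M.
  rewrite linearZ /= -scalemxAl -scalemxAr scalerA [v *m _]mx11_scalar -qq.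
  rewrite scale_scalar_mx; congr (_%:M); by field.
have uA : u *m A = a *: u by rewrite -scalemxAl vA !scalerA mulrC.
have [H HH eH] := householder uu; have HTH := mulmx1C HH.
pose e : 'rV[R]_n.+1 := delta_mx 0 0.
pose B : 'M[R]_(1 + n) := H *m A *m H^T.
have symB : B^T = B by rewrite /B !trmx_mul trmxK symA mulmxA.
have eB : e *m B = a *: e.
  by rewrite /B !mulmxA eH uA -scalemxAl -eH -mulmxA HH mulmx1.
have B0 j : B 0 j = a * (j == 0)%:R.
  by move/rowP/(_ j): eB; rewrite -rowE !mxE eqxx.
pose B' := drsubmx B.
have defB : B = block_mx a%:M 0 0 B'.
  have l0 (i : 'I_1) : lshift n i = 0 by apply: val_inj; rewrite /= ord1.
  rewrite -[LHS]submxK; congr block_mx; apply/matrixP => i j.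
  - by rewrite mxE mxE l0 B0 [in RHS]mxE !ord1 /= mulr1 mulr1n.
  - by rewrite mxE mxE l0 B0 [in RHS]mxE mulr0.
  - by rewrite mxE mxE l0 -[B]symB mxE B0 [in RHS]mxE mulr0.
have symB' : B'^T = B' by rewrite /B' trmx_drsub symB.
have chiB' : char_poly B' = \prod_(b <- r) ('X - b%:P).
  have : char_poly B = char_poly A by exact: char_poly_similar.
  rewrite chiA big_cons defB /char_poly char_block_diag_mx det_ublock.
  rewrite -[\det (char_poly_mx a%:M)]/(char_poly a%:M).
  rewrite char_poly_trig ?scalar_mx_is_trig//.
  rewrite big_ord1 mxE eqxx mulr1n => /mulfI; apply.
  by rewrite polyXsubC_eq0.
have [Q QQ QB] := IHn B' r symB' chiB'.
pose Q1 : 'M[R]_(1 + n) := block_mx 1%:M 0 0 Q.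
have Q1Q1 : Q1 *m Q1^T = 1%:M.
  rewrite /Q1 tr_block_mx mulmx_block trmx1 !trmx0 QQ.
  by rewrite !(mulmx0, mul0mx, mulmx1, addr0, add0r) -scalar_mx_block.
have diagE : diag_mx (\row_i (a :: r)`_i) =
    block_mx a%:M 0 0 (diag_mx (\row_i r`_i)) :> 'M[R]_(1 + n).
  rewrite (_ : \row_i (a :: r)`_i = row_mx a%:M (\row_i r`_i) :> 'rV_(1 + n)).
    by rewrite diag_mx_row; congr block_mx; apply/matrixP => i j; rewrite !mxE !ord1.
  rewrite -[LHS]hsubmxK; congr row_mx; apply/rowP => i; rewrite !mxE ?ord1//=.
have Q1B : Q1 *m B = diag_mx (\row_i (a :: r)`_i) *m Q1.
  rewrite diagE defB /Q1 !mulmx_block !(mulmx0, mul0mx, addr0, add0r).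
  by rewrite mulmx1 mul1mx QB.
exists (Q1 *m H); first by rewrite trmx_mul mulmxA -[Q1 *m H *m _]mulmxA HH mulmx1.
have -> : Q1 *m H *m A = Q1 *m B *m H by rewrite /B -!mulmxA HTH mulmx1.
by rewrite Q1B mulmxA.
Qed.

End SymmetricDiagonalization.

(** * The eigenframe of the metric *)

Section EigenFrame.
Context (R : realType).
Implicit Types (i j k l : 'I_3).

Lemma ip0C (A B : 'M[R]_3) : ip0 A B = ip0 B A.
Proof.
rewrite !ip0E; congr (_ * _); apply: eq_bigr => i _; apply: eq_bigr => j _.
exact: mulrC.
Qed.

Lemma so3_basis_frame : so3_frame (@so3_basis R).
Proof.
split=> [k|k|i j|A sA].
- by rewrite /so3 linearB /= !trmx_delta opprB.
- apply/matrixP => i j; rewrite !mxE !sum3 !mxE.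
  by elim/ord3_ind: k; elim/ord3_ind: i; elim/ord3_ind: j; rewrite !ord3E /=; ring.
- rewrite ip0E !sum3 !mxE.
  by elim/ord3_ind: i; elim/ord3_ind: j; rewrite !ord3E /=; field.
- apply/matrixP => i j; rewrite summxE sum3 !mxE !ip0E !sum3 !mxE.
  have e01 := so3E 0 1 sA; have e02 := so3E 0 2%:R sA.
  have e12 := so3E 1 2%:R sA; have d := so3_diag _ sA.
  by elim/ord3_ind: i; elim/ord3_ind: j; rewrite !ord3E /= ?d ?e01 ?e02 ?e12; field.
Qed.

(** Here [t] is the triple product of the rows, that is the determinant of [Q]. The cross product of
    two rows is orthogonal to both, hence a multiple of the third; its norm is 1 by
    [lagrange_identity] with unit weights. *)
Lemma orthogonal_cross (Q : 'M[R]_3) : Q *m Q^T = 1%:M ->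
  exists2 t : R, t ^+ 2 = 1 &
    forall k l, cross (Q k) (Q (k + 1)) l = t * Q (k + 2%:R) l.
Proof.
move=> QQ; have QTQ := mulmx1C QQ.
pose t := \sum_l cross (Q 0) (Q 1) l * Q 2%:R l.
have dot_cross i k : \sum_l Q i l * cross (Q k) (Q (k + 1)) l = t * (i == k + 2%:R)%:R.
  rewrite /t /cross !sum3.
  by elim/ord3_ind: i; elim/ord3_ind: k; rewrite !ord3E /=; ring.
have dot i j : \sum_l Q i l * Q j l = (i == j)%:R.
  have /matrixP/(_ i j) := QQ; rewrite !mxE => <-.
  by apply: eq_bigr => l _; rewrite mxE.
have crossE k l : cross (Q k) (Q (k + 1)) l = t * Q (k + 2%:R) l.
  pose c := \col_i cross (Q k) (Q (k + 1)) i.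
  have : Q^T *m (Q *m c) = c by rewrite mulmxA QTQ mul1mx.
  move/matrixP/(_ l 0); rewrite !mxE => <-.
  rewrite (bigD1 (k + 2%:R))//= big1 => [|i /negbTE nik].
    rewrite addr0 !mxE mulrC; congr (_ * _).
    by under eq_bigr do rewrite mxE; rewrite dot_cross eqxx mulr1.
  rewrite !mxE; under eq_bigr do rewrite mxE.
  by rewrite dot_cross nik !mulr0.
have one (f : 'I_3 -> R) : \sum_l 1 * f l = \sum_l f l.
  by apply: eq_bigr => l _; rewrite mul1r.
have := lagrange_identity (fun=> 1) (Q 0) (Q 1).
rewrite !one !dot /= expr0n subr0 mulr1 => cross_norm.
exists t => //.
transitivity (t ^+ 2 * \sum_l Q 2%:R l * Q 2%:R l); first by rewrite dot eqxx mulr1.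
rewrite cross_norm mulr_sumr; apply: eq_bigr => l _.
by have := crossE 0 l; rewrite !ord3E !mul1r => ->; rewrite exprMn -expr2.
Qed.

(** Brackets of combinations of the basis are cross products of the coefficient rows, which settles
    the bracket relation; [Q *m Q^T = 1%:M] gives orthonormality and [Q^T *m Q = 1%:M] gives
    spanning. *)
Lemma rotated_frame (Q : 'M[R]_3) : Q *m Q^T = 1%:M ->
  (forall k l, cross (Q k) (Q (k + 1)) l = Q (k + 2%:R) l) ->
  so3_frame (fun k => \sum_l Q k l *: so3_basis R l).
Proof.
move=> QQ crossQ; have fL := so3_basis_frame; have QTQ := mulmx1C QQ.
have sL := frame_so3 fL.
have so3_sum (c : 'I_3 -> R) : so3 (\sum_l c l *: so3_basis R l).
  have := tangent_field_of fL (fun l _ => c l) (SO3_one R).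
  by rewrite /tangent /field_of /= trmx1 mul1mx; under eq_bigr do rewrite mul1mx.
split=> [k|k|i j|A sA].
- exact: so3_sum.
- rewrite (frame_commutator fL (Q k) (Q (k + 1))).
  by apply: eq_bigr => l _; rewrite crossQ.
- rewrite ip0_sum; have /matrixP/(_ i j) := QQ; rewrite !mxE => <-.
  apply: eq_bigr => a _; congr (_ * _); rewrite ip0C ip0_sum (bigD1 a)//= big1.
    by rewrite (frame_orthonormal fL) eqxx mulr1 addr0 mxE.
  by move=> b /negbTE nba; rewrite (frame_orthonormal fL) nba mulr0.
rewrite [LHS](frame_span fL sA).
under [RHS]eq_bigr do rewrite scaler_sumr.
rewrite exchange_big /=; apply: eq_bigr => l _.
under eq_bigr do rewrite scalerA.
rewrite -scaler_suml; congr (_ *: _).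
under eq_bigr do rewrite ip0C ip0_sum mulr_suml.
rewrite exchange_big /=.
have inner b : \sum_k Q k b * ip0 (so3_basis R b) A * Q k l =
    (b == l)%:R * ip0 A (so3_basis R b).
  have /matrixP/(_ b l) := QTQ; rewrite !mxE => <-; rewrite mulr_suml.
  by apply: eq_bigr => k _; rewrite mxE ip0C mulrAC.
under eq_bigr do rewrite inner.
rewrite (bigD1 l)//= big1 => [|b /negbTE nbl]; last by rewrite nbl mul0r.
by rewrite eqxx mul1r addr0.
Qed.

Lemma eigenframe (m : metric_field R) (r : seq R) :
  left_invariant m -> metric_eigenvalues m r ->
  exists2 e : 'I_3 -> 'M[R]_3, so3_frame e &
    forall p i j, m p (val p *m e i) (val p *m e j) = r`_i * (i == j)%:R.
Proof.
move=> linv [phi [M [[phi_so3 phi_lin phi_sym _ m_phi] phiL chiM]]].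
have fL := so3_basis_frame; have sL := frame_so3 fL.
have L_orth := frame_orthonormal fL.
have ML i j : ip0 (phi (so3_basis R i)) (so3_basis R j) = M j i.
  rewrite phiL ip0_sum (bigD1 j)//= big1 => [|k /negbTE nkj].
    by rewrite L_orth eqxx mulr1 addr0.
  by rewrite L_orth nkj mulr0.
(* Self-adjointness of [phi] read in an orthonormal basis. *)
have symM : M^T = M.
  by apply/matrixP => i j; rewrite mxE -ML phi_sym// ip0C ML.
have [Q [QQ crossQ QM]] : exists Q : 'M[R]_3, [/\ Q *m Q^T = 1%:M,
    forall k l, cross (Q k) (Q (k + 1)) l = Q (k + 2%:R) l
    & Q *m M = diag_mx (\row_i r`_i) *m Q].
  have [Q QQ QM] := orthogonal_diagonalization symM chiM.
  have [t /eqP] := orthogonal_cross QQ; rewrite sqrf_eq1 => /orP[]/eqP-> crossQ.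
    by exists Q; split=> // k l; rewrite crossQ mul1r.
  (* Negation leaves cross products of rows unchanged but flips the rows, so it turns [t = -1] into
     [t = 1]. *)
  exists (- Q); split=> [|k l|].
  - by rewrite linearN /= mulNmx mulmxN opprK.
  - rewrite /cross !mxE !mulrNN; rewrite -/(cross (Q k) (Q (k + 1)) l).
    by rewrite crossQ mulN1r.
  - by rewrite mulNmx mulmxN QM.
have fe := rotated_frame QQ crossQ.
exists (fun k => \sum_l Q k l *: so3_basis R l) => //.
set e := fun k => _ in fe *; have se := frame_so3 fe.
have phi0 : phi 0 = 0.
  have s0 : so3 (0 : 'M[R]_3) by rewrite /so3 linear0 oppr0.
  by have := phi_lin 1 0 0 s0 s0; rewrite scaler0 addr0 scale1r => /eqP;
    rewrite -subr_eq0 opprD addNKr oppr_eq0 => /eqP.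
have phi_sum (c : 'I_3 -> R) :
    phi (\sum_l c l *: so3_basis R l) = \sum_l c l *: phi (so3_basis R l).
  pose P (x y : 'M[R]_3) := so3 x /\ phi x = y.
  suff [] : P (\sum_l c l *: so3_basis R l) (\sum_l c l *: phi (so3_basis R l)) by [].
  apply: (big_rec2 P) => [|l x y _ [sx <-]].
    by split=> //; rewrite /so3 linear0 oppr0.
  split; last by rewrite phi_lin.
  by rewrite /so3 linearD linearZ /= sL sx scalerN opprD.
have phie k : phi (e k) = r`_k *: e k.
  rewrite /e phi_sum; under eq_bigr do rewrite phiL scaler_sumr.
  rewrite exchange_big scaler_sumr /=; apply: eq_bigr => i _.
  under eq_bigr do rewrite scalerA; rewrite -scaler_suml scalerA; congr (_ *: _).
  (* The matrix of [phi] acts on coefficient columns while the eigenvectors are rows of [Q]; the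
     symmetry of [M] reconciles the two. *)
  have /matrixP/(_ k i) := QM; rewrite mul_diag_mx !mxE => <-.
  by apply: eq_bigr => j _; rewrite -{1}symM mxE.
move=> p i j; have := linv p (SO3_one R) (e i) (e j).
have tangent1 A : so3 A -> tangent (SO3_one R) A by rewrite /tangent /= trmx1 mul1mx.
rewrite (_ : SO3_mul p (SO3_one R) = p); last by apply: val_inj; rewrite /= mulmx1.
move=> ->; [|exact: tangent1..].
rewrite m_phi// phie -[r`_i *: e i]addr0 ip0_linear (frame_orthonormal fe).
by rewrite /ip0 mul0mx linear0 mulr0 addr0.
Qed.

End EigenFrame.

Theorem proposition3p1 (R : realType) (l1 l2 : R) (m : metric_field R) :
  0 < l1 -> 0 < l2 ->
  riemannian_metric m -> left_invariant m ->
  metric_eigenvalues m [:: l1 ^+ 2; l2 ^+ 2; 1] ->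
  (nonneg_sectional_curvature m <->
   [/\ 0 <= 2 * l1 ^+ 2 + 2 * l2 ^+ 2 - 3 + l1 ^+ 4
            - 2 * l1 ^+ 2 * l2 ^+ 2 + l2 ^+ 4,
       0 <= 2 * l1 ^+ 2 - 3 * l1 ^+ 4 + 2 * l1 ^+ 2 * l2 ^+ 2
            - 2 * l2 ^+ 2 + 1 + l2 ^+ 4
     & 0 <= 2 * l2 ^+ 2 - 3 * l2 ^+ 4 + 2 * l1 ^+ 2 * l2 ^+ 2
            - 2 * l1 ^+ 2 + 1 + l1 ^+ 4]).
Proof.
move=> l1_gt0 l2_gt0 riem linv eig; have [e he m_frame] := eigenframe linv eig.
pose mu (k : 'I_3) := [:: l1 ^+ 2; l2 ^+ 2; 1]`_k.
have mu_gt0 k : 0 < mu k by elim/ord3_ind: k; rewrite /mu /= ?exprn_gt0.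
rewrite (nonneg_sectional_curvatureP he mu_gt0 riem m_frame) /mu.
(* The eigenvalue [1] has index 2, so the first inequality is the case [k = 2], and the other two
   are [k = 0] and [k = 1]. *)
split=> [curv|[c2 c0 c1] k].
  have := (curv 0, curv 1, curv 2%:R); rewrite !ord3E /= => -[[c0 c1] c2].
  by split; [move: c2|move: c0|move: c1]; congr (0 <= _); ring.
elim/ord3_ind: k; rewrite !ord3E /=; [move: c0|move: c1|move: c2];
  by congr (0 <= _); ring.
Qed.
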